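(* Assume that a $\overleftrightarrow{\mathrm{mid}}$-convex analytic set $A$ in a Polish group $X$ is winning at some point $a\in A$. Then the following conditions are equivalent: (1) $A-A$ is not a neighborhood of zero in $X$; (2) $A-A$ is meager in $X$; (3) $A$ is generically Haar-$1$; (4) $A$ is Haar-thin; (5) $A$ is null-finite; (6) $A$ is Haar-scattered. If the subgroup $\frac{\theta}{2^{\mathbb N}}$ is closed in $X$, then the conditions (1)--(6) are equivalent to (7) $A$ is Haar-countable.
   Context: All groups are Abelian, written additively, with neutral element $\theta$; a Polish group is a topological group whose underlying space is Polish. $\mathbb N=\{1,2,\dots\}$. A space is analytic if it is a continuous image of a Polish space. For $c\in X$ put $\frac12c:=\{x\in X:x+x=c\}$; for $B\subset X$ put $\frac1{2^n}B:=\{x\in X:2^nx\in B\}$; $\frac{\theta}{2^{\mathbb N}}:=\bigcup_{n\in\mathbb N}\{x\in X:2^nx=\theta\}$. A subset $A\subset X$ is mid-convex if $\emptyset\ne\frac12(a+b)\subset A$ for all $a,b\in A$. $A$ is $\overleftrightarrow{\mathrm{mid}}$-convex if it is mid-convex and for any points $a,b\in A$ and any neighborhood $U\subset A$ of $a$ in $A$ there exists $x\in U$ such that $2^n(x-a)=b-a$ for some $n\in\mathbb N$. Convexity Game on a mid-convex set $A$ with $\theta\in A$: in the $n$-th inning ($n=1,2,\dots$) player I chooses a neighborhood $U_n\subset X$ of $\theta$ and player II responds by selecting a point $a_n\in U_n\cap\frac1{2^n}A$. Player I wins if the series $\sum_{n=1}^\infty a_n$ converges to a point of $A$; otherwise II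 wins. A mid-convex set $A$ is winning at a point $a\in A$ if player I has a winning strategy in the Convexity Game on $A-a$. Smallness notions for $A\subset X$ ($2^\omega=\{0,1\}^\omega$ is the Cantor cube). Generically Haar-$1$: the set $\{f\in C(2^\omega,X):\forall x\in X\;|f^{-1}(A+x)|\le1\}$ is comeager in the space $C(2^\omega,X)$ of continuous maps with the compact-open topology. Haar-thin: there is a continuous $f:2^\omega\to X$ such that for every $x\in X$ the set $f^{-1}(A+x)$ is thin, where $T\subset2^\omega$ is thin if for every $n\in\omega$ the map $T\ni x\mapsto x|_{\omega\setminus\{n\}}$ is injective. Null-finite: there is a continuous map $f:\omega+1\to X$ ($\omega+1$ with the order topology) such that $f^{-1}(A+x)$ is finite for every $x\in X$. Haar-scattered (resp. Haar-countable): there is a continuous map $f:2^\omega\to X$ such that $f^{-1}(A+x)$ is scattered, i.e. each of its nonempty subspaces has an isolated point (resp. countable), for every $x\in X$. *)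

(* Defs.v *)
From HB Require Import structures.
From mathcomp Require Import all_boot all_order all_algebra.
From mathcomp Require Import all_classical all_reals all_analysis.

Set Implicit Arguments.
Unset Strict Implicit.
Unset Printing Implicit Defensive.

Import Order.TTheory GRing.Theory Num.Theory.

Local Open Scope classical_set_scope.
Local Open Scope ring_scope.

Section DescriptiveTopology.

Definition homeomorphic (S T : topologicalType) : Prop :=
  exists (f : S -> T) (g : T -> S),
    [/\ continuous f, continuous g, cancel f g & cancel g f].

Definition separable (T : topologicalType) : Prop :=
  exists2 D : set T, countable D & dense D.

Definition completely_metrizable (R : realType) (T : topologicalType) : Prop :=
  exists2 M : metricType R,
    (forall F : set_system M, ProperFilter F -> cauchy F -> exists x : M, F --> x) &
    homeomorphic T M.

(* All realTypes are isomorphic, so the choice of R is immaterial. *)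
Definition polish_space (R : realType) (T : topologicalType) : Prop :=
  separable T /\ completely_metrizable R T.

Definition analytic (R : realType) (T : topologicalType) (A : set T) : Prop :=
  exists2 Z : topologicalType, polish_space R Z &
    exists2 f : Z -> T, continuous f & range f = A.

Definition nowhere_dense (T : topologicalType) (A : set T) : Prop :=
  (closure A)° = set0.

Definition meager (T : topologicalType) (A : set T) : Prop :=
  exists2 F : nat -> set T, (forall n, nowhere_dense (F n)) &
    A `<=` \bigcup_n F n.

Definition comeager (T : topologicalType) (A : set T) : Prop := meager (~` A).

Definition scattered (T : topologicalType) (A : set T) : Prop :=
  forall B : set T, B `<=` A -> B !=set0 -> isolated B !=set0.

Definition thin (T : set cantor_space) : Prop :=
  forall n : nat,
    set_inj T (fun (x : cantor_space) (m : {m : nat | m != n}) => x (val m)).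

End DescriptiveTopology.

(* The ordinal omega + 1: Some n is the finite ordinal n, None is omega. *)
Definition omega_plus_one : Type := option nat.

Section OmegaPlusOne.

Definition omega_le (x y : omega_plus_one) : bool :=
  match x, y with
  | _, None => true
  | None, Some _ => false
  | Some m, Some n => (m <= n)%N
  end.

Let omega_le_refl : reflexive omega_le.
Proof. by case=> //= n. Qed.

Let omega_le_anti : antisymmetric omega_le.
Proof. by move=> [m|] [n|] //=; rewrite -eqn_leq => /eqP ->. Qed.

Let omega_le_trans : transitive omega_le.
Proof. by move=> [m|] [n|] [p|] //=; exact: leq_trans. Qed.

Let omega_le_total : total omega_le.
Proof. by move=> [m|] [n|] //=; exact: leq_total. Qed.

HB.instance Definition _ := Choice.on omega_plus_one.
HB.instance Definition _ := Order.Le_isPOrder.Build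
  Order.default_display omega_plus_one
  omega_le_refl omega_le_anti omega_le_trans.
HB.instance Definition _ := Order.POrder_isTotal.Build
  Order.default_display omega_plus_one omega_le_total.

End OmegaPlusOne.

Section GroupSets.
Variable X : zmodType.
Implicit Types (A B : set X) (c x : X).

Definition half c : set X := [set x | x + x = c].

Definition dyadic_preimage (n : nat) B : set X := [set x | B (x *+ 2 ^ n)].

Definition dyadic_torsion : set X :=
  \bigcup_(n in [set n : nat | (0 < n)%N]) [set x | x *+ 2 ^ n = 0].

Definition translate A x : set X := [set a + x | a in A].

Definition diff_set A : set X := [set a - b | a in A & b in A].

Definition mid_convex A : Prop :=
  forall a b, A a -> A b -> half (a + b) !=set0 /\ half (a + b) `<=` A.

End GroupSets.

Section ConvexityGame.
Variable X : topologicalZmodType.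
Implicit Types (A : set X) (a x : X).

Definition bimid_convex A : Prop :=
  mid_convex A /\
  forall a b, A a -> A b ->
  forall U : set X, U `<=` A -> within A (nbhs a) U ->
  exists2 x, U x & exists2 n : nat, (0 < n)%N & (x - a) *+ 2 ^ n = b - a.

(* A strategy of player I answers the finite sequence of points chosen so far
   by player II.  Innings are numbered from 0, so that a n below is the point
   a_(n+1) of the game. *)
Definition strategyI := seq X -> set X.

Definition legal_strategyI (sigma : strategyI) : Prop :=
  forall s : seq X, nbhs (0 : X) (sigma s).

Definition consistent_run A (sigma : strategyI) (a : nat -> X) : Prop :=
  forall n, (sigma (mkseq a n) `&` dyadic_preimage n.+1 A) (a n).

Definition convexity_game_won A : Prop :=
  exists2 sigma : strategyI, legal_strategyI sigma &
    forall a : nat -> X, consistent_run A sigma a ->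
      exists2 x, A x & series a @ \oo --> x.

Definition winning_at A a : Prop := convexity_game_won (translate A (- a)).

End ConvexityGame.

Section HaarSmall.
Variable X : topologicalZmodType.
Implicit Type A : set X.

Section CompactOpen.
(* Topologizes [continuousType cantor_space X] by the compact-open topology. *)
Import ArrowAsCompactOpen.

Definition generically_haar1 A : Prop :=
  comeager [set f : continuousType cantor_space X |
    forall x : X, is_subset1 (f @^-1` translate A x)].

End CompactOpen.

Definition haar_thin A : Prop :=
  exists2 f : cantor_space -> X, continuous f &
    forall x : X, thin (f @^-1` translate A x).

Definition null_finite A : Prop :=
  exists2 f : order_topology omega_plus_one -> X, continuous f &
    forall x : X, finite_set (f @^-1` translate A x).

Definition haar_scattered A : Prop :=
  exists2 f : cantor_space -> X, continuous f &
    forall x : X, scattered (f @^-1` translate A x).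

Definition haar_countable A : Prop :=
  exists2 f : cantor_space -> X, continuous f &
    forall x : X, countable (f @^-1` translate A x).

End HaarSmall.

(* Main.v *)
From mathcomp Require Import all_boot all_order all_algebra.
From mathcomp Require Import zify.
From mathcomp Require Import all_classical all_reals all_analysis.
Require Import Defs.

(** The conditions are all compared with the first one.

    If [A - A] is not a neighborhood of zero, then [A] is small.  A nonmeager
    set [S] given by a Souslin scheme contains a nonempty open set up to a meager
    one, so [S - S] is a neighborhood of zero ([diff_set_nbhs], Pettis).  For
    [S = A - A], midpoints turn [(a - b) - (c - d)] into [2 (m - m')] with [m] and
    [m'] in [A], and elements of order two can be added to points of [A]; hence
    [A - A] itself would be a neighborhood of zero if it were nonmeager
    ([diff_set_meager]).  Once [A - A] is meager, a map [f] of the Cantor cube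
    can be perturbed to a locally constant one with values in general position,
    so the maps with [f u - f v] outside [A - A] for all [u <> v] are comeager
    ([meager_generically_haar1]).  The function space is a Baire space, so such
    a map exists; its preimages of translates of [A] are at most singletons, so it
    witnesses all the other smallness conditions.

    Conversely suppose that [A - A] is a neighborhood of zero.  Then [A] is not
    Haar-thin, because changing a far coordinate changes [f] by an element of
    [A - A].  For the remaining conditions the game is played at zero, after a
    translation.  The key point is that small differences are realized by legal
    moves: for every [n] and every neighborhood [U] of zero, all small elements
    are of the form [p - q] with [p], [q] in [U] and [2^n p], [2^n q] in [A]
    ([diff_set_dyadic_local]).  Build a tree of points [c n], each child so
    close to its parent that the difference of their [f]-values is [p n - q n],
    where [p n] and [q n] are legal answers of player II in inning [n] against
    all the finitely many histories made of earlier [p]'s and [q]'s.  Following a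
    branch from the root amounts to playing [p n] instead of [q n] in the
    innings of that branch.  The winning strategy puts the sum of the resulting
    series in [A], whence the [f]-values at all limits of branches lie in one
    translate of [A] ([game_tree]).  A tree of height one with infinitely many
    leaves in [omega + 1] refutes null-finiteness; a binary tree in the Cantor
    cube gives a perfect set of branch points, which refutes Haar-scatteredness
    and Haar-countability. *)

Set Implicit Arguments.
Unset Strict Implicit.
Unset Printing Implicit Defensive.

Import Order.TTheory GRing.Theory Num.Theory.

Local Open Scope classical_set_scope.
Local Open Scope ring_scope.

(** * Ball systems and Baire category *)

(** The balls of radius [2^-k] of a metric.  Keeping only these sets, rather than
    a homeomorphism with a metric space, lets the same lemmas serve a Polish
    group and the space of maps from the Cantor cube into it. *)
Record ball_system (T : topologicalType) (B : nat -> T -> set T) : Prop := {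
  ball_nbhs : forall k x, nbhs x (B k x);
  ball_base : forall x O, nbhs x O -> exists k, B k x `<=` O;
  ball_symm : forall k x y, B k x y -> B k y x;
  ball_trans : forall k x y z, B k.+1 x y -> B k.+1 y z -> B k x z
}.

(** The sequences considered are Cauchy at the fixed rate [2^-k], which is enough
    since every Cauchy sequence has such a subsequence. *)
Definition complete_balls (T : topologicalType) (B : nat -> T -> set T) : Prop :=
  forall u : nat -> T, (forall k l, (k <= l)%N -> B k (u k) (u l)) ->
  exists x : T, u @ \oo --> x.

Definition dense_sequence (T : topologicalType) (d : nat -> T) : Prop :=
  forall O : set T, O !=set0 -> open O -> exists n, O (d n).

Section BallSystem.
Context (T : topologicalType) (B : nat -> T -> set T) (bB : ball_system B).

Lemma ball_refl k x : B k x x.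
Proof. exact: nbhs_singleton (ball_nbhs bB k x). Qed.

Lemma ball_le k l x : (k <= l)%N -> B l x `<=` B k x.
Proof.
move=> /subnK <-; elim: (l - k)%N => [|m IH] //= y.
by rewrite addSn => xy; apply: IH; apply: ball_trans bB _ _ _ _ xy (ball_refl _ _).
Qed.

Lemma ball_open_sub k x : B k.+1 x `<=` (B k x)°.
Proof.
move=> y xy; apply: filterS (ball_nbhs bB k.+1 y) => z yz.
exact: ball_trans bB _ _ _ _ xy yz.
Qed.

Lemma ball_lim (u : nat -> T) y k x :
  u @ \oo --> y -> (\forall n \near \oo, B k.+1 x (u n)) -> B k x y.
Proof.
move=> uy ux; have : \forall n \near \oo, B k.+1 x (u n) /\ B k.+1 y (u n).
  by apply: filterI => //; exact: uy (ball_nbhs bB _ _).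
case/filter_ex => n [xn yn].
exact: ball_trans bB _ _ _ _ xn (ball_symm bB yn).
Qed.

End BallSystem.

Lemma polish_balls (R : realType) (T : topologicalType) : polish_space R T ->
  exists2 B : nat -> T -> set T, ball_system B & complete_balls B.
Proof.
move=> [_ [M cM [f [g [cf cg fK gK]]]]].
pose r k : R := 2^-1 ^+ k; pose B k x : set T := f @^-1` ball (f x) (r k).
have r0 k : 0 < r k by rewrite exprn_gt0// invr_gt0.
have rS k : r k = r k.+1 + r k.+1.
  by rewrite /r exprS -mulrDl -[X in X + X]mul1r -splitr mul1r.
have rlt e : 0 < e -> \forall k \near \oo, r k < e.
  move=> e0; have := near_infty_natSinv_expn_lt (PosNum e0).
  by apply: filterS => k; rewrite /r exprVn mul1r.
exists B; first split.
- by move=> k x; apply: cf; exact: nbhsx_ballx.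
- move=> x O xO; have /cg/nbhs_ballP [e /= e0 eO] : nbhs (g (f x)) O.
    by rewrite fK.
  have [k ke] := filter_ex (rlt _ e0); exists k => y xy.
  by rewrite -(fK y); apply: eO; exact: le_ball (ltW ke) _ xy.
- by move=> k x y /ball_sym.
- by move=> k x y z xy yz; rewrite /B /preimage /= rS; exact: ball_triangle xy yz.
move=> u cu; have [|m um] := cM (f \o u @ \oo) _.
  apply/cauchy_ballP => e e0; have [k ke] := filter_ex (rlt (e / 2) (divr_gt0 e0 (ltr0Sn _ 1))).
  have near_k : \forall n \near \oo, ball (f (u k)) (e / 2) (f (u n)).
    by exists k => // n /= kn; apply: le_ball (ltW ke) _ (cu _ _ kn).
  exists ([set x | ball (f (u k)) (e / 2) x], [set x | ball (f (u k)) (e / 2) x]) => //=.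
  case=> a b /= [ka kb]; rewrite [e]splitr; exact: ball_triangle (ball_sym ka) kb.
exists (g m); have -> : u = g \o (f \o u) by apply/funext => n /=; rewrite fK.
exact: cvg_comp um (cg m).
Qed.

Lemma polish_hausdorff (R : realType) (T : topologicalType) :
  polish_space R T -> hausdorff_space T.
Proof.
move=> [_ [M _ [f [g [cf _ fK _]]]]] x y cxy.
apply: (can_inj fK); apply: metric_hausdorff => U V /cf fU /cf fV.
by have [z [Uz Vz]] := cxy _ _ fU fV; exists (f z).
Qed.

Lemma separable_dense_sequence (T : topologicalType) (t0 : T) : separable T ->
  exists d : nat -> T, dense_sequence d.
Proof.
move=> [D /countable_injP [h hinj] dD].
exists (fun n => xget t0 [set x | D x /\ h x = n]) => O /dD H /H [x [Ox Dx]].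
exists (h x); case: xgetP => [y _ [Dy hyx]|/(_ x)]; last by case.
by rewrite (hinj y x) // inE.
Qed.

Lemma nowhere_denseP (T : topologicalType) (F : set T) :
  nowhere_dense F <-> forall O : set T, open O -> O !=set0 ->
    exists O' : set T, [/\ open O', O' !=set0, O' `<=` O & O' `&` F = set0].
Proof.
split=> [ndF O oO [x Ox]|H].
  exists (O `&` ~` closure F); split.
  - by apply: openI => //; apply: closed_openC; exact: closed_closure.
  - apply: contrapT => /set0P/negP/negPn/eqP OF.
    have : (closure F)° x.
      rewrite /interior; apply: filterS (open_nbhs_nbhs (conj oO Ox)) => y Oy.
      by apply: contrapT => Fy; have : (O `&` ~` closure F) y by []; rewrite OF.
    by rewrite ndF.
  - exact: subIsetl.
  - by rewrite -subset0 => y [[_ nFy] /subset_closure].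
rewrite /nowhere_dense -subset0 => x Fx.
have [||O' [oO' [y O'y] O'F OF0]] := H (closure F)°; [exact: open_interior|by exists x|].
have : closure F y by exact: interior_subset (O'F _ O'y).
move=> /(_ _ (open_nbhs_nbhs (conj oO' O'y))) [z [Fz O'z]].
by have : (O' `&` F) z by []; rewrite OF0.
Qed.

Lemma nowhere_dense_closure (T : topologicalType) (F : set T) :
  nowhere_dense F -> nowhere_dense (closure F).
Proof. by rewrite /nowhere_dense -((closure_id _).1 (@closed_closure _ F)). Qed.

Lemma meagerS (T : topologicalType) (A A' : set T) :
  A `<=` A' -> meager A' -> meager A.
Proof. by move=> AA' [F ndF A'F]; exists F => //; exact: subset_trans A'F. Qed.

Lemma nowhere_dense_meager (T : topologicalType) (A : set T) :
  nowhere_dense A -> meager A.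
Proof. by move=> ndA; exists (fun=> A) => // x Ax; exists 0%N. Qed.

Lemma meager_bigcup (T : topologicalType) (I : countType) (A : I -> set T) :
  (forall i, meager (A i)) -> meager (\bigcup_i A i).
Proof.
move=> mA; have [F FA] := choice (fun i => let: ex_intro2 F a b := mA i in
  ex_intro (fun F => (forall n, nowhere_dense (F n)) /\ A i `<=` \bigcup_n F n) F (conj a b)).
have nd0 : nowhere_dense (@set0 T) by rewrite /nowhere_dense closure0 interior0.
exists (fun n => if (unpickle n : option (I * nat)%type) is Some (i, m) then F i m else set0).
  by move=> n; case: unpickle => // -[i m]; exact: (FA i).1.
move=> x [i _ /(FA i).2 [m _ Fx]].
by exists (pickle (i, m)); rewrite // pickleK.
Qed.

Lemma meagerU (T : topologicalType) (A A' : set T) :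
  meager A -> meager A' -> meager (A `|` A').
Proof.
move=> mA mA'; apply: (@meagerS _ _ (\bigcup_(b : bool) if b then A else A')).
  by move=> x [Ax|A'x]; [exists true|exists false].
by apply: meager_bigcup => -[].
Qed.

(** Both a map and its inverse are needed: preimages of nowhere dense sets under a
    mere continuous map may have interior. *)
Lemma meager_homeo (T : topologicalType) (f g : T -> T) (A : set T) :
  continuous f -> continuous g -> cancel f g -> cancel g f ->
  meager A -> meager (f @^-1` A).
Proof.
move=> cf cg fK gK [F ndF AF]; exists (fun n => f @^-1` F n); last first.
  by move=> x /AF [n _ Fx]; exists n.
move=> n; apply/nowhere_denseP => O oO [x Ox].
have [||O' [oO' [y O'y] O'O O'F]] := (nowhere_denseP _).1 (ndF n) (g @^-1` O).
- by apply: open_comp => // z _; exact: cg.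
- by exists (f x); rewrite /preimage /= fK.
exists (f @^-1` O'); split.
- by apply: open_comp => // z _; exact: cf.
- by exists (g y); rewrite /preimage /= gK.
- by move=> z O'z; have := O'O _ O'z; rewrite /preimage /= fK.
- by rewrite -subset0 => z [ O'z Fz]; have : (O' `&` F n) (f z) by []; rewrite O'F.
Qed.

(** Baire's theorem by nested balls: the [n]-th ball avoids the [n]-th nowhere
    dense set, and the centers are Cauchy at the prescribed rate. *)
Theorem baire_balls (T : topologicalType) (B : nat -> T -> set T) :
  ball_system B -> complete_balls B ->
  forall O : set T, open O -> O !=set0 -> ~ meager O.
Proof.
move=> bB cB O oO [x0 Ox0] [F ndF OF].
have step (s : nat * (T * nat)) : exists t : T * nat,
    [/\ (s.2.2 < t.2)%N, B s.2.2.+1 s.2.1 t.1 & B t.2 t.1 `<=` B s.2.2.+1 s.2.1 `&` ~` F s.1].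
  case: s => n [x r] /=.
  have [||O' [oO' [y O'y] O'B O'F]] := (nowhere_denseP _).1 (ndF n) (B r.+1 x)°.
  - exact: open_interior.
  - exists x; exact: (ball_nbhs bB).
  have [k kO'] := ball_base bB (open_nbhs_nbhs (conj oO' O'y)).
  exists (y, maxn k r.+1); split=> /=.
  - by rewrite leq_max ltnSn orbT.
  - exact: interior_subset (O'B _ O'y).
  - move=> z /(ball_le bB (leq_maxl _ _))/kO' O'z; split.
      exact: interior_subset (O'B _ O'z).
    by move=> Fz; have : (O' `&` F n) z by []; rewrite O'F.
have [nxt nxtP] := choice step.
have [r0 r0O] := ball_base bB (open_nbhs_nbhs (conj oO Ox0)).
pose s := fix s n := if n is m.+1 then nxt (m, s m) else (x0, r0).
have sr n : (n <= (s n).2)%N.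
  by elim: n => // n IH; apply: leq_ltn_trans IH _; case: (nxtP (n, s n)).
have sle n m : (n <= m)%N -> B (s m).2 (s m).1 `<=` B (s n).2 (s n).1.
  move=> /subnK <-; elim: (m - n)%N => //= k IH.
  have [_ _ /= h] := nxtP ((k + n)%N, s (k + n)%N).
  by apply: subset_trans IH => z /h [] /(ball_le bB (leqnSn _)).
have sS n m : (n < m)%N -> B (s n).2.+1 (s n).1 (s m).1.
  move=> /sle h; have [_ _ /= H] := nxtP (n, s n).
  by apply: (H _ (h _ (ball_refl bB _ _))).1.
have [k l|y sy] := cB (fun n => (s n).1).
  rewrite leq_eqVlt => /predU1P[->|/sS]; first exact: ball_refl.
  by apply: ball_le => //; exact: leqW.
have yB n : B (s n).2 (s n).1 y.
  apply: (ball_lim bB sy); exists n.+1 => // m /= nm; exact: sS.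
have [n _ Fy] := OF y (r0O y (yB 0%N)).
have [_ _ /= /(_ _ (yB n.+1)) [] _] := nxtP (n, s n).
exact.
Qed.

(** * Souslin schemes and the Baire property *)

(** A Souslin scheme whose nonempty branches shrink to a point of the set.  This
    shape, rather than a continuous image of a Polish space, makes the stability
    under products and closed intersections immediate, with no Polish structure
    on a product or on a subspace. *)
Definition sieved (T : topologicalType) (S : set T) : Prop :=
  exists (I : countType) (P : seq I -> set T),
    [/\ P [::] = S,
        forall s, P s = \bigcup_i P (rcons s i) &
        forall b : nat -> I, (forall n, P (mkseq b n) !=set0) ->
          exists2 y, S y & forall O, nbhs y O -> exists n, P (mkseq b n) `<=` O].

Lemma scheme_le (T : topologicalType) (I : countType) (P : seq I -> set T) (b : nat -> I) :
  (forall s, P s = \bigcup_i P (rcons s i)) ->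
  forall n m, (n <= m)%N -> P (mkseq b m) `<=` P (mkseq b n).
Proof.
move=> PE n m /subnK <-; elim: (m - n)%N => //= k IH; rewrite addSn.
by apply: subset_trans IH => x Px; rewrite PE; exists (b (k + n)%N); rewrite // -mkseqS.
Qed.

Lemma sieved_image (T T' : topologicalType) (f : T -> T') (S : set T) :
  continuous f -> sieved S -> sieved (f @` S).
Proof.
move=> cf [I [P [P0 PE Pb]]]; exists I, (fun s => f @` P s); split.
- by rewrite P0.
- by move=> s; rewrite [in LHS]PE image_bigcup.
- move=> b Pn; have [n|y Sy yP] := Pb b; first by have [_ [x Px _]] := Pn n; exists x.
  exists (f y); first by exists y.
  by move=> O /cf /yP [n PO]; exists n => _ [x /PO ? <-].
Qed.

(** The two schemes run in parallel, on sequences of pairs of indices. *)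
Lemma sieved_image2 (T1 T2 T' : topologicalType) (f : T1 * T2 -> T')
    (S1 : set T1) (S2 : set T2) :
  continuous f -> sieved S1 -> sieved S2 ->
  sieved [set f (x, y) | x in S1 & y in S2].
Proof.
move=> cf [I [P [P0 PE Pb]]] [J [Q [Q0 QE Qb]]].
exists (I * J)%type, (fun s => [set f (x, y) | x in P (map fst s) & y in Q (map snd s)]).
split.
- by rewrite /= P0 Q0.
- move=> s; apply/seteqP; split => [_ [x Px [y Qy <-]]|z [[i j] _]].
    move: Px Qy; rewrite PE QE => -[i _ Px] [j _ Qy].
    by exists (i, j) => //; rewrite !map_rcons; exists x => //; exists y.
  rewrite !map_rcons => -[x Px [y Qy <-]].
  by exists x; [rewrite PE; exists i|exists y => //; rewrite QE; exists j].
- move=> b; have map_fst n : map fst (mkseq b n) = mkseq (fst \o b) n by rewrite /mkseq -map_comp.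
  have map_snd n : map snd (mkseq b n) = mkseq (snd \o b) n by rewrite /mkseq -map_comp.
  move=> PQn.
  have [n|x Sx xP] := Pb (fst \o b).
    by have [_ [x Px _]] := PQn n; rewrite -map_fst; exists x.
  have [n|y Sy yQ] := Qb (snd \o b).
    by have [_ [_ _ [y Qy _]]] := PQn n; rewrite -map_snd; exists y.
  exists (f (x, y)); first by exists x => //; exists y.
  move=> O /cf [[U V] /= [/xP [n PU] /yQ [m QV]] UVO].
  exists (maxn n m) => _ [x' Px [y' Qy <-]]; apply: (UVO (x', y')); split => /=.
    by apply/PU/(scheme_le PE (leq_maxl n m)); rewrite -map_fst.
  by apply/QV/(scheme_le QE (leq_maxr n m)); rewrite -map_snd.
Qed.

Lemma sievedI_closed (T : topologicalType) (S F : set T) :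
  closed F -> sieved S -> sieved (S `&` F).
Proof.
move=> cF [I [P [P0 PE Pb]]]; exists I, (fun s => P s `&` F); split.
- by rewrite P0.
- by move=> s; rewrite [in LHS]PE setI_bigcupl.
- move=> b Pn; have [n|y Sy yP] := Pb b; first by have [x [Px _]] := Pn n; exists x.
  exists y; last by move=> O /yP [n PO]; exists n => x [/PO].
  split=> //; apply: cF => O /yP [n PO].
  by have [x [Px Fx]] := Pn n; exists x; split => //; exact: PO.
Qed.

(** The node of a sequence [s] is the image of the intersection of the balls of
    radius [2^-k] around the points of a dense sequence numbered by [s]. *)
Lemma analytic_sieved (R : realType) (T : topologicalType) (S : set T) :
  analytic R S -> S !=set0 -> sieved S.
Proof.
move=> [Z pZ [f cf <-]] [_ [z0 _ _]]; apply: sieved_image => //.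
have [B bB cB] := polish_balls pZ.
have [d dd] := separable_dense_sequence z0 pZ.1.
pose P s := [set z : Z | forall k, (k < size s)%N -> B k (d (nth 0%N s k)) z].
exists nat, P; split.
- by apply/seteqP; split.
- move=> s; apply/seteqP; split => [z Pz|z [i _ Pz] k ks].
    have [||i zi] := dd (B (size s) z)°.
    + by exists z; exact: (ball_nbhs bB).
    + exact: open_interior.
    exists i => // k; rewrite size_rcons ltnS leq_eqVlt nth_rcons => /predU1P[->|ks].
      by rewrite ltnn eqxx; apply: (ball_symm bB); exact: interior_subset zi.
    by rewrite ks; exact: Pz.
  by have := Pz k; rewrite size_rcons nth_rcons ks; apply; exact: ltnW.
- move=> b /choice [u uP].
  have uB k n : (k < n)%N -> B k (d (b k)) (u n).
    by move=> kn; have := uP n k; rewrite size_mkseq nth_mkseq //; apply.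
  have [k l kl|y uy] := cB (fun k => u k.+2).
    by apply: (ball_trans bB (ball_symm bB (uB k.+1 _ _)) (uB k.+1 _ _)); rewrite ?ltnS ?leqW.
  exists y => // O /(ball_base bB) [k kO]; exists k.+3 => z Pz; apply: kO.
  have zB : B k.+2 (d (b k.+2)) z.
    by have := Pz k.+2; rewrite size_mkseq nth_mkseq //; apply.
  have /filter_ex [n [kn yun]] :
      \forall n \near \oo, (k < n)%N /\ B k.+1 y (u n.+2).
    by apply: filterI; [exists k.+1|exact: uy (ball_nbhs bB _ _)].
  apply: (ball_trans bB yun _).
  exact: (ball_trans bB (ball_symm bB (uB k.+2 n.+2 kn)) zB).
Qed.

Definition open_base (T : topologicalType) (V : nat -> set T) : Prop :=
  (forall n, open (V n)) /\
  forall x O, nbhs x O -> exists2 n, V n x & V n `<=` O.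

Lemma ball_open_base (T : topologicalType) (B : nat -> T -> set T) (d : nat -> T) :
  ball_system B -> dense_sequence d -> exists V : nat -> set T, open_base V.
Proof.
move=> bB dd.
exists (fun n => if (unpickle n : option (nat * nat)%type) is Some (k, m) then (B k (d m))° else setT).
split=> [n|x O /(ball_base bB) [k kO]].
  by case: unpickle => [[k m]|]; [exact: open_interior|exact: openT].
have [||m xm] := dd (B k.+2 x)°; [by exists x; exact: (ball_nbhs bB)|exact: open_interior|].
exists (pickle (k.+1, m)); rewrite pickleK.
  by apply: (ball_open_sub bB); apply: (ball_symm bB); exact: interior_subset xm.
move=> y /interior_subset my; apply: kO; apply: (ball_trans bB _ my).
by apply: (ball_le bB (leqnSn _)); exact: interior_subset xm.
Qed.

(** The points at which [S] is locally nonmeager: the closed set that replaces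
    [S] modulo meager sets in the Baire property. *)
Definition nonmeager_points (T : topologicalType) (S : set T) : set T :=
  [set x | forall O, nbhs x O -> ~ meager (S `&` O)].

Section NonmeagerPoints.
Context (T : topologicalType) (V : nat -> set T) (bV : open_base V).
Implicit Type S : set T.

Lemma nonmeager_points_closed S : closed (nonmeager_points S).
Proof.
move=> x cx O; rewrite nbhsE => -[W [oW Wx] WO].
have [y [Sy Wy]] := cx _ (open_nbhs_nbhs (conj oW Wx)) => mO.
apply: (Sy W (open_nbhs_nbhs (conj oW Wy))).
by apply: meagerS mO => z [Sz /WO].
Qed.

Lemma nonmeager_points_closure S : nonmeager_points S `<=` closure S.
Proof.
move=> x Sx O /Sx mO; apply/set0P/eqP => SO0; apply: mO; rewrite SO0.
by apply: nowhere_dense_meager; rewrite /nowhere_dense closure0 interior0.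
Qed.

(** Banach's category theorem; with a countable base it is a countable union. *)
Lemma meager_outside_nonmeager_points S : meager (S `\` nonmeager_points S).
Proof.
pose M n := [set x | [/\ S x, V n x & meager (S `&` V n)]].
apply: (@meagerS _ _ (\bigcup_n M n)) => [x [Sx /existsNP [ O /not_implyP [xO /contrapT mO]]]|].
  have [n Vx VO] := bV.2 _ _ xO; exists n => //; split=> //.
  by apply: meagerS mO => z [Sz /VO].
apply: meager_bigcup => n; have [mV|nmV] := pselect (meager (S `&` V n)).
  by apply: meagerS mV => x [].
by apply: (@meagerS _ _ set0) => [x []//|]; apply: nowhere_dense_meager;
  rewrite /nowhere_dense closure0 interior0.
Qed.

(** If this difference were dense in an open set, then [S] would be meager there,
    since each [P i] is meager off [nonmeager_points (P i)] and the boundary of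
    that closed set is nowhere dense. *)
Lemma nonmeager_points_split (I : countType) (S : set T) (P : I -> set T) :
  S = \bigcup_i P i ->
  nowhere_dense (nonmeager_points S `\` \bigcup_i nonmeager_points (P i)).
Proof.
move=> SE; set E := @nonmeager_points T.
pose H := E S `&` ~` \bigcup_i (E (P i))°.
have cH : closed H.
  apply: closedI; first exact: nonmeager_points_closed.
  by apply: open_closedC; apply: bigcup_open => i _; exact: open_interior.
suff H0 : H° = set0.
  rewrite /nowhere_dense -subset0 -H0; apply: interiorS.
  rewrite [X in _ `<=` X]((closure_id _).1 cH); apply: closure_subset.
  by move=> x [Sx nPx]; split => // -[i _ /interior_subset Px]; apply: nPx; exists i.
rewrite -subset0 => x Hx; have [Sx _] := interior_subset Hx.
apply: (Sx H°); first by apply: open_nbhs_nbhs; split => //; exact: open_interior.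
apply: (@meagerS _ _ (\bigcup_i ((P i `\` E (P i)) `|` (E (P i) `\` (E (P i))°)))).
  move=> y [+ /interior_subset [_ Hy]]; rewrite SE => -[i _ Py]; exists i => //.
  have [Ey|nEy] := pselect (E (P i) y); [right|by left].
  by split=> // Ei; apply: Hy; exists i.
apply: meager_bigcup => i; apply: meagerU; first exact: meager_outside_nonmeager_points.
apply: nowhere_dense_meager; rewrite /nowhere_dense -subset0 => z.
have cE : closed (E (P i) `\` (E (P i))°).
  by apply: closedI; [exact: nonmeager_points_closed|apply: open_closedC; exact: open_interior].
rewrite -((closure_id _).1 cE) => zE.
have [_ nz] := interior_subset zE; apply: nz.
by apply: filterS zE => w [].
Qed.

End NonmeagerPoints.

(** Nonmeager Souslin sets have a comeager trace on some open set.  Off the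
    countably many exceptional sets of [nonmeager_points_split], a point at which
    [S] is locally nonmeager can be followed down the scheme, being locally
    nonmeager for each node; the branch obtained shrinks to that very point,
    which therefore belongs to [S]. *)
Lemma sieved_comeager (T : topologicalType) (V : nat -> set T) (S : set T) :
  hausdorff_space T -> open_base V -> sieved S -> ~ meager S ->
  exists O : set T, [/\ open O, O !=set0 & meager (O `\` S)].
Proof.
move=> hT bV [I [P [P0 PE Pb]]] nmS; set E := @nonmeager_points T.
pose H s := E (P s) `\` \bigcup_i E (P (rcons s i)).
have ndH s : nowhere_dense (H s) := nonmeager_points_split bV (PE s).
exists (E S)°; split; first exact: open_interior.
  apply/set0P/eqP => ES0; apply: nmS.
  apply: (@meagerS _ _ ((S `\` E S) `|` E S)).
    by move=> x Sx; have [|] := pselect (E S x); [right|left].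
  apply: meagerU; first exact: (meager_outside_nonmeager_points bV).
  apply: nowhere_dense_meager; rewrite /nowhere_dense.
  by rewrite -((closure_id _).1 (@nonmeager_points_closed _ S)).
apply: (@meagerS _ _ (\bigcup_s H s)); last first.
  by apply: meager_bigcup => s; exact: nowhere_dense_meager.
move=> x [/interior_subset ESx nSx]; apply: contrapT => nHx; apply: nSx.
have /choice [nxt nxtP] (s : seq I) : exists i : option I, E (P s) x ->
    exists2 j, i = Some j & E (P (rcons s j)) x.
  have [Ex|nEx] := pselect (E (P s) x); last by exists None.
  apply: contrapT => nex; apply: nHx; exists s => //; split=> // -[i _ Ei].
  by apply: nex; exists (Some i) => _; exists i.
have [i0 _] : exists i : I, True.
  have [i _ _] : exists2 j, nxt [::] = Some j & E (P (rcons [::] j)) x.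
    by apply: nxtP; rewrite P0.
  by exists i.
pose s := fix s n := if n is m.+1 then rcons (s m) (odflt i0 (nxt (s m))) else [::].
pose b n := odflt i0 (nxt (s n)).
have sE n : mkseq b n = s n by elim: n => // n IH; rewrite mkseqS IH.
have Es n : E (P (mkseq b n)) x.
  rewrite sE; elim: n => [|n /nxtP [j nj Ej]] /=; first by rewrite P0.
  by rewrite nj.
have [n|y Sy yP] := Pb b.
  by have [z [Pz _]] := nonmeager_points_closure (Es n) (@filterT _ _ _); exists z.
suff -> : x = y by [].
apply: hT => U W xU /yP [n PW].
by have [z [Pz Uz]] := nonmeager_points_closure (Es n) xU; exists z; split => //; exact: PW.
Qed.

(** * Difference sets in Polish groups *)

Section Group.
Context (X : topologicalZmodType).
Implicit Types (A S U : set X) (x y : X).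

Lemma addr_shift_continuous x : continuous (fun y : X => y + x).
Proof.
move=> y; apply: (@continuous_comp _ _ _ (fun y : X => (y, x)) (fun p : X * X => p.1 + p.2)).
  by apply: cvg_pair => /=; [exact: cvg_id|exact: cvg_cst].
exact: add_continuous.
Qed.

Lemma mulrn_continuous n : continuous (fun x : X => x *+ n).
Proof.
elim: n => [|n IH].
  have -> : (fun x : X => x *+ 0) = cst 0 by apply/funext => x; rewrite mulr0n.
  exact: cst_continuous.
have -> : (fun x : X => x *+ n.+1) = (fun x => x + x *+ n).
  by apply/funext => x; rewrite mulrS.
move=> x; apply: (@continuous_comp _ _ _ (fun y : X => (y, y *+ n)) (fun p : X * X => p.1 + p.2)).
  by apply: cvg_pair => /=; [exact: cvg_id|exact: IH].
exact: add_continuous.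
Qed.

Lemma nbhs0D U : nbhs 0 U ->
  exists2 V, nbhs 0 V & forall x y, V x -> V y -> U (x + y).
Proof.
move=> U0; have : nbhs ((0 : X) + 0) U by rewrite addr0.
move=> /(@add_continuous X (0, 0)) [[V1 V2] /= [V10 V20] VU].
exists (V1 `&` V2); first exact: filterI.
by move=> x y [V1x _] [_ V2y]; exact: (VU (x, y)).
Qed.

Lemma nbhs0B U : nbhs 0 U ->
  exists2 V, nbhs 0 V & forall x y, V x -> V y -> U (x - y).
Proof.
move=> U0; have : nbhs ((0 : X) - 0) U by rewrite subr0.
move=> /(@sub_continuous X (0, 0)) [[V1 V2] /= [V10 V20] VU].
exists (V1 `&` V2); first exact: filterI.
by move=> x y [V1x _] [_ V2y]; exact: (VU (x, y)).
Qed.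

Lemma nbhs0_mulrn n U : nbhs 0 U -> nbhs 0 [set x : X | U (x *+ n)].
Proof.
move=> U0; have U0n : nbhs ((0 : X) *+ n) U by rewrite mul0rn.
exact: (@mulrn_continuous n 0 U U0n).
Qed.

Lemma nbhs_shift x U : nbhs x U -> nbhs 0 [set y | U (x + y)].
Proof.
move=> xU; have xU0 : nbhs (0 + x) U by rewrite add0r.
under eq_set => y do rewrite addrC.
exact: (@addr_shift_continuous x 0 U xU0).
Qed.

Lemma nbhs_unshift x U : nbhs 0 U -> nbhs x [set y | U (y - x)].
Proof.
move=> U0; have Ux : nbhs (x - x) U by rewrite subrr.
exact: (@addr_shift_continuous (- x) x U Ux).
Qed.

Lemma meager_shift x A : meager A -> meager [set y | A (y + x)].
Proof.
apply: (@meager_homeo _ _ (fun y => y - x)); try exact: addr_shift_continuous.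
- exact: addrK.
- exact: subrK.
Qed.

Lemma sieved_diff_set S : sieved S -> sieved (diff_set S).
Proof. by move=> sS; have := sieved_image2 (@sub_continuous X) sS sS. Qed.

End Group.

Section PolishGroup.
Context (R : realType) (X : topologicalZmodType) (polishX : polish_space R X).
Implicit Types (A S U : set X) (x y : X).

Lemma nonmeager_nbhs x U : nbhs x U -> ~ meager U.
Proof.
rewrite nbhsE => -[W [oW Wx] WU] mU.
have [B bB cB] := polish_balls polishX.
by apply: (baire_balls bB cB oW); [exists x|exact: meagerS mU].
Qed.

Lemma closed_nbhs x U : nbhs x U -> exists2 V, nbhs x V & closed V /\ V `<=` U.
Proof.
have [B bB _] := polish_balls polishX.
move=> /(ball_base bB) [k kU]; exists (closure (B k.+1 x)).
  by apply: filterS (ball_nbhs bB k.+1 x); exact: subset_closure.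
split; first exact: closed_closure.
move=> y cy; apply: kU; have [z [xz yz]] := cy _ (ball_nbhs bB k.+1 y).
exact: ball_trans bB _ _ _ _ xz (ball_symm bB yz).
Qed.

(** Pettis: if [S] is comeager in an open set [W], then for small [x] the sets [W]
    and [W - x] overlap in a nonempty open set, in which [S] and [S - x] are both
    comeager and hence meet. *)
Lemma diff_set_nbhs S : sieved S -> ~ meager S -> nbhs 0 (diff_set S).
Proof.
have [B bB _] := polish_balls polishX.
have [d dd] := separable_dense_sequence (0 : X) polishX.1.
have [V bV] := ball_open_base bB dd.
move=> sS nmS.
have [W [oW [w Ww] mW]] := sieved_comeager (polish_hausdorff polishX) bV sS nmS.
have nbW := open_nbhs_nbhs (conj oW Ww).
apply: filterS (nbhs_shift nbW) => x /= Wx.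
pose W1 := W `&` [set z | W (z + x)].
have nbW1 : nbhs w W1.
  apply: filterI => //; apply: addr_shift_continuous.
  exact: open_nbhs_nbhs.
apply: contrapT => nx; apply: (nonmeager_nbhs nbW1).
apply: meagerS (meagerU mW (meager_shift x mW)) => z [Wz Wzx].
have [Sz|nSz] := pselect (S z); last by left.
right; split=> // Szx; apply: nx; exists (z + x) => //; exists z => //.
by rewrite addrC addKr.
Qed.

End PolishGroup.

(** * Mid-convex sets *)

Section MidConvex.
Context (X : zmodType) (A : set X) (mA : mid_convex A).

Lemma mid_convex_half a b x : A a -> A b -> x + x = a + b -> A x.
Proof. by move=> Aa Ab xx; apply: (mA Aa Ab).2. Qed.

(** The points [u + 2^i (w - u)] with [i <= n] start at [w] and end at [v], and each
    is a midpoint of [u] and the next one. *)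
Lemma mid_convex_dyadic n u v w :
  A u -> A v -> (w - u) *+ 2 ^ n = v - u -> A w.
Proof.
move=> Au Av; elim: n w => [|n IH] w; first by rewrite expn0 mulr1n => /addIr ->.
rewrite expnS mulrnA => wE.
apply: (@mid_convex_half u (u + (w - u) *+ 2)) => //.
  by apply: IH; rewrite addrAC subrr add0r.
by rewrite mulr2n addrA addrACA !subrKC.
Qed.

(** A point of [A] may be corrected by 2-power torsion; this is what allows division by
    [2^n] of equations between points of [A]. *)
Lemma mid_convex_torsion n a t : A a -> t *+ 2 ^ n = 0 -> A (a + t).
Proof.
move=> Aa t0; apply: (@mid_convex_dyadic n a a) => //.
by rewrite subrr addrAC subrr add0r.
Qed.

End MidConvex.

Section Difference.
Context (R : realType) (X : topologicalZmodType) (polishX : polish_space R X).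
Context (A : set X) (sA : sieved A) (mA : mid_convex A).

(** Otherwise [(A - A) - (A - A)] is a neighborhood of zero by Pettis; if it
    contains [2 x], then taking midpoints gives [2 x = 2 (m - m')], and
    [x - (m - m')], being of order two, can be absorbed in [m]. *)
Lemma diff_set_meager : ~ nbhs 0 (diff_set A) -> meager (diff_set A).
Proof.
move=> nA; apply: contrapT => /(diff_set_nbhs polishX (sieved_diff_set sA)) ddA.
apply: nA; apply: filterS (nbhs0_mulrn 2 ddA) => x /=.
move=> [_ [a Aa [b Ab <-]] [_ [c Ac [d Ad <-]] xE]].
have [[m /= mE] _] := mA Aa Ad; have [[m' /= m'E] _] := mA Ab Ac.
have Am := mid_convex_half mA Aa Ad mE; have Am' := mid_convex_half mA Ab Ac m'E.
exists (x + m'); last by exists m' => //; rewrite addrK.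
rewrite -(subrKC m (x + m')); apply: (mid_convex_torsion mA (n := 1)) => //.
rewrite expn1 mulrnBl mulrnDl -xE !mulr2n mE m'E.
by rewrite opprB [a - b + _]addrACA -opprD subrK subrr.
Qed.

Hypothesis A0 : A 0.

(** Open mapping theorem for [x |-> 2 x]: its range contains [A - A] because every
    point [a] of [A] is twice a midpoint of [a] and [0], so the range is nonmeager, and
    so is the image of every neighborhood of zero. *)
Lemma doubling_open (U : set X) : nbhs 0 (diff_set A) -> nbhs 0 U ->
  nbhs 0 [set x + x | x in U].
Proof.
move=> nA /nbhs0B [V V0 VU].
have [W W0 [cW WV]] := closed_nbhs polishX V0.
have [d dd] := separable_dense_sequence (0 : X) polishX.1.
have dblE (z : X) : z + z = z *+ 2 by rewrite mulr2n.
have sXT : sieved [set: X].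
  apply: (@analytic_sieved R); last by exists 0.
  exists X => //; exists id; first by move=> z; exact: cvg_id.
  by apply/seteqP; split => // z _; exists z.
have sW : sieved [set x + x | x in W].
  have -> : [set x + x | x in W] = (fun x : X => x *+ 2) @` ([set: X] `&` W).
    by rewrite setTI; apply: eq_imagel => z _; rewrite mulr2n.
  by apply: sieved_image (sievedI_closed cW sXT); exact: mulrn_continuous.
have nmW : ~ meager [set x + x | x in W].
  move=> mW; apply: (nonmeager_nbhs polishX nA).
  apply: (@meagerS _ _ (\bigcup_n [set y | [set x + x | x in W] (y - d n *+ 2)])).
    move=> _ [a Aa [b Ab <-]].
    have [[h /= hE] _] := mA Aa A0; have [[h' /= h'E] _] := mA Ab A0.
    have [||n dn] := dd [set y | W (h - h' - y)]°; [|exact: open_interior|].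
      exists (h - h'); have W0' : nbhs (h - h' - (h - h')) W by rewrite subrr.
      have := @sub_continuous X (h - h', h - h') W W0'.
      case=> -[P Q] /= [Ph Qh] PQ; apply: filterS Qh => y Qy.
      by apply: (PQ (h - h', y)); split => //=; exact: nbhs_singleton Ph.
    exists n => //=; exists (h - h' - d n); first exact: (interior_subset dn).
    by rewrite dblE !mulrnBl !mulr2n hE h'E !addr0.
  by apply: meager_bigcup => n; exact: (meager_shift (- (d n *+ 2)) mW).
apply: filterS (diff_set_nbhs polishX sW nmW) => _ [_ [x Wx <-] [_ [y Wy <-] <-]].
exists (x - y); first by apply: VU; exact: WV.
by rewrite !dblE mulrnBl.
Qed.

Lemma dyadic_open n (U : set X) : nbhs 0 (diff_set A) -> nbhs 0 U ->
  nbhs 0 [set x *+ 2 ^ n | x in U].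
Proof.
move=> nA; elim: n U => [|n IH] U U0.
  by apply: filterS U0 => x Ux; exists x.
apply: filterS (IH _ (doubling_open nA U0)) => _ [_ [x Ux <-] <-].
by exists x; rewrite // expnS mulrnA mulr2n.
Qed.

End Difference.

Section LocalDifference.
Context (R : realType) (X : topologicalZmodType) (polishX : polish_space R X).
Context (A : set X) (sA : sieved A) (bA : bimid_convex A) (A0 : A 0).
Hypothesis nA : nbhs 0 (diff_set A).

(** Given [b] and [c] in [A], pick [x] near zero with [2^n x = b], a root [c'] in
    [A] of [2^n c' = c], and then [y] near [x] with [2^m (y - x) = c' - x]; this
    gives [2^(m + n) (y - x) = c - b]. *)
Lemma diff_set_local_cover (U : set X) : nbhs 0 U ->
  diff_set A `<=` \bigcup_n [set z *+ 2 ^ n | z in diff_set (A `&` U)].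
Proof.
move=> U0 _ [c Ac [b Ab <-]]; have [mA dA] := bA.
have wU x : A x -> U° x -> within A (nbhs x) (A `&` U°).
  move=> Ax Ux; rewrite /within /=; apply: filterS (open_nbhs_nbhs (conj (open_interior U) Ux)) => y Uy Ay.
  by split.
have [//|//|||x [Ax Ux] [n n0 xE]] := dA 0 b _ _ (A `&` U°).
- by move=> x [].
- exact: wU.
have [c' Ac' cE] : exists2 c', A c' & c' *+ 2 ^ n = c.
  elim: n {n0 xE} c Ac => [|n IH] c Ac; first by exists c; rewrite ?expn0.
  have [[h /= hE] _] := mA _ _ Ac A0.
  have [c' Ac' cE] := IH h (mid_convex_half mA Ac A0 hE).
  by exists c'; rewrite // expnSr mulrnA cE mulr2n hE addr0.
have [//|//|||y [Ay Uy] [m m0 yE]] := dA x c' _ _ (A `&` U°).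
- by move=> z [].
- exact: wU.
exists (m + n)%N => //; exists (y - x).
  exists y; first by split => //; exact: interior_subset.
  by exists x => //; split => //; exact: interior_subset.
by rewrite expnD mulrnA yE mulrnBl cE -[x]subr0 xE subr0.
Qed.

(** For some [n] the set [P n] is nonmeager, so for small [v] the element
    [2^n.+1 v] is [2^n] times a combination of four small points of [A]. By openness
    of doubling their sums in pairs have small midpoints [m] and [m'], and
    [v - (m - m')] is torsion that can be absorbed in [m]. *)
Lemma diff_set_local (U : set X) : nbhs 0 U -> nbhs 0 (diff_set (U `&` A)).
Proof.
move=> /nbhs0D [W W0 WU]; have [mA _] := bA.
have [V V0 VW] := nbhs0D (doubling_open polishX mA A0 nA W0).
have [F F0 [cF FV]] := closed_nbhs polishX V0.
have sB : sieved (A `&` F) by exact: sievedI_closed.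
pose P n := [set z *+ 2 ^ n | z in diff_set (A `&` F)].
have [n nmP] : exists n, ~ meager (P n).
  apply: contrapT => /forallNP mP; apply: (nonmeager_nbhs polishX nA).
  apply: meagerS (diff_set_local_cover F0) _.
  by apply: meager_bigcup => n; exact: contrapT (mP n).
have sP : sieved (P n).
  by apply: sieved_image (sieved_diff_set sB); exact: mulrn_continuous.
apply: filterS (filterI W0 (nbhs0_mulrn (2 ^ n.+1) (diff_set_nbhs polishX sP nmP))).
move=> v [Wv [_ [_ [b1 [A1 F1] [b2 [A2 F2] <-]] <-] [_ [_ [b3 [A3 F3] [b4 [A4 F4] <-]] <-] vE]]].
have [m Wm mE] := VW _ _ (FV _ F1) (FV _ F4).
have [m' Wm' m'E] := VW _ _ (FV _ F2) (FV _ F3).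
have Am := mid_convex_half mA A1 A4 mE; have Am' := mid_convex_half mA A2 A3 m'E.
have W00 := nbhs_singleton W0.
exists (v + m'); last first.
  by exists m'; [split=> //; rewrite -[m']add0r; exact: WU|rewrite addrK].
split; first exact: WU.
rewrite -(subrKC m (v + m')); apply: (mid_convex_torsion mA (n := n.+1)) => //.
rewrite mulrnBl mulrnDl -vE expnS !mulrnA !mulr2n mE m'E -mulrnBl -!mulrnDl -mulrnBl.
by rewrite opprB [b1 - b2 + _]addrACA -opprD subrK subrr mul0rn.
Qed.

(** Divide a representation of [2^n v] given by [diff_set_local]: only its first
    point needs a small root [p], as [p - v] is then a root of the second one. *)
Lemma diff_set_dyadic_local n (U : set X) : nbhs 0 U ->
  nbhs 0 (diff_set (U `&` dyadic_preimage n A)).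
Proof.
move=> U0; have [mA _] := bA; have [W W0 WU] := nbhs0B U0.
have nD := dyadic_open polishX mA A0 n nA W0.
apply: filterS (filterI W0 (nbhs0_mulrn (2 ^ n) (diff_set_local nD))).
move=> v [Wv [_ [[p Wp <-] Ap] [b [_ Ab] vE]]].
exists p; first by split => //; rewrite -[p]subr0; apply: WU => //; exact: nbhs_singleton.
exists (p - v); last by rewrite opprB addrC subrK.
by split; [exact: WU|rewrite /dyadic_preimage /= mulrnBl -vE subKr].
Qed.

End LocalDifference.

(** * The convexity game along a tree of points *)

(** The node reached before inning [n] by the branch whose innings are marked by
    [I]; inning [m] leads to node [m.+1], and node [0] is the root. *)
Fixpoint cur (I : nat -> bool) (n : nat) : nat :=
  if n is m.+1 then (if I m then m.+1 else cur I m) else 0%N.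

Lemma nbhs_forall (T : topologicalType) (I : finType) (t : T) (P : I -> set T) :
  (forall i, nbhs t (P i)) -> nbhs t [set x | forall i, P i x].
Proof. by move=> nP; apply: filter_forall. Qed.

Section Game.
Context (X : topologicalZmodType) (hX : hausdorff_space X) (A : set X).
Hypothesis winA : convexity_game_won A.
Hypothesis locA : forall n (U : set X), nbhs 0 U ->
  nbhs 0 (diff_set (U `&` dyadic_preimage n A)).
Context (T : topologicalType) (f : T -> X) (cf : continuous f).
Context (F : T -> nat -> T) (cF : forall t, F t @ \oo --> t).
Context (j : nat -> nat) (jle : forall n, (j n <= n)%N) (t0 : T).

(** In a tree where node [n.+1] is a child of node [j n], the points attached to
    the children of a node [t] are taken from the sequence [F t], which converges
    to [t], and the parameters [d] increase.  All branches stay in one translate of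
    [A], namely by [f t0 - z], where [z] is the sum of the series played when
    [q n] is chosen in every inning. *)
Lemma game_tree : exists (d : nat -> nat) (c : nat -> T) (x : X),
  [/\ forall n, (d n < d n.+1)%N,
      c 0%N = t0,
      forall n, c n.+1 = F (c (j n)) (d n) &
      forall (I : nat -> bool) (y : X), (forall n, I n -> j n = cur I n) ->
        f (c (cur I n)) @[n --> \oo] --> y -> translate A x y].
Proof.
have [sigma lsigma sigmaP] := winA.
(* The default entry is never reached; an entry is ((p n, q n), (d n, c n.+1)). *)
pose e0 : X * X * (nat * T) := ((0, 0), (0%N, t0)).
pose run (h : seq (X * X * (nat * T))) (J : nat -> bool) :=
  mkseq (fun i => if J i then (nth e0 h i).1.1 else (nth e0 h i).1.2) (size h).
pose par (h : seq (X * X * (nat * T))) := nth t0 (t0 :: [seq e.2.2 | e <- h]) (j (size h)).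
have step (h : seq (X * X * (nat * T))) : exists e : X * X * (nat * T),
    [/\ forall b : (size h).-tuple bool,
          sigma (run h (nth false b)) e.1.1 /\ sigma (run h (nth false b)) e.1.2,
        dyadic_preimage (size h).+1 A e.1.1 /\ dyadic_preimage (size h).+1 A e.1.2,
        e.1.1 - e.1.2 = f e.2.2 - f (par h),
        e.2.2 = F (par h) e.2.1 &
        (last 0%N [seq e.2.1 | e <- h] < e.2.1)%N].
  have nU : nbhs (0 : X) [set x | forall b : (size h).-tuple bool, sigma (run h (nth false b)) x].
    by apply: nbhs_forall => b; exact: lsigma.
  have nfF : \forall d \near \oo, diff_set ([set x | forall b : (size h).-tuple bool,
      sigma (run h (nth false b)) x] `&` dyadic_preimage (size h).+1 A)
      (f (F (par h) d) - f (par h)).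
    exact: (cF (cf (nbhs_unshift (f (par h)) (locA (size h).+1 nU)))).
  have [d [[p [Up Ap] [q [Uq Aq] pq]] ltd]] :=
    filter_ex (filterI nfF (nbhs_infty_gt (last 0%N [seq e.2.1 | e <- h]))).
  by exists ((p, q), (d, F (par h) d)).
have [nxt nxtP] := choice step.
pose s := fix s n := if n is m.+1 then rcons (s m) (nxt (s m)) else [::].
pose e n := nxt (s n).
have sE n : s n = mkseq e n by elim: n => // n IH; rewrite mkseqS -IH.
have szs n : size (s n) = n by rewrite sE size_mkseq.
pose p n := (e n).1.1; pose q n := (e n).1.2; pose d n := (e n).2.1.
pose c n := if n is m.+1 then (e m).2.2 else t0.
have parE n : par (s n) = c (j n).
  rewrite /par szs; have := jle n; case: (j n) => // k kn /=.
  by rewrite (nth_map e0) ?szs // sE nth_mkseq.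
have eP n := nxtP (s n).
have pqE n : p n - q n = f (c n.+1) - f (c (j n)).
  by have [_ _ + _ _] := eP n; rewrite parE.
(* Along a branch the partial sums telescope to differences of values of [f]. *)
have seriesE (I : nat -> bool) : (forall n, I n -> j n = cur I n) -> forall n,
    f (c (cur I n)) = series (fun n => if I n then p n else q n) n - series q n + f t0.
  move=> Ij; elim=> [|n IH]; first by rewrite /series /= !big_geq // subrr add0r.
  rewrite /series /= !big_nat_recr //= opprD addrACA -!/(series _ _).
  case: ifPn => [In|_]; last by rewrite subrr addr0.
  rewrite pqE (Ij _ In) IH [_ + (f _ - _)]addrC -addrA.
  by rewrite subrK.
have runP (I : nat -> bool) : consistent_run A sigma (fun n => if I n then p n else q n).
  move=> n; have [/(_ [tuple of mkseq I (size (s n))]) [sp sq] [Ap Aq] _ _ _] := eP n.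
  have runE : run (s n) (nth false (mkseq I (size (s n)))) =
      mkseq (fun n => if I n then p n else q n) n.
    rewrite /run szs; apply: (@eq_from_nth _ 0); rewrite !size_mkseq // => i ilt.
    by rewrite !nth_mkseq // sE nth_mkseq.
  rewrite /= runE in sp sq; rewrite szs in Ap Aq.
  by case: ifP => _; split.
have [z Az qz] := sigmaP _ (runP (fun=> false)).
exists d, c, (f t0 - z); split=> //.
- move=> n; have [_ _ _ _] := eP n.+1.
  by rewrite [s n.+1]/= map_rcons last_rcons.
- by move=> n; have [_ _ _ + _] := eP n; rewrite parE.
move=> I y Ij fy; have [x Ax ax] := sigmaP _ (runP I).
suff -> : y = x + (f t0 - z) by exists x.
apply: (cvg_unique hX fy) => /=.
under eq_fun do rewrite (seriesE I Ij).
rewrite [f t0 - z]addrC addrA.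
have axqz : series (fun n => if I n then p n else q n) n - series q n @[n --> \oo] --> x - z.
  exact: (cvg_comp _ _ (cvg_pair ax qz) (@sub_continuous X (x, z))).
exact: (cvg_comp _ _ axqz (@addr_shift_continuous _ (f t0) (x - z))).
Qed.

End Game.

(** * The Cantor cube and the ordinal omega + 1 *)

Definition cyl (u : cantor_space) n : set cantor_space :=
  [set v | forall i, (i < n)%N -> v i = u i].

Lemma cyl_nbhs u n : nbhs u (cyl u n).
Proof.
elim: n => [|n IH]; first by apply: filterS filterT => v _ i.
have : nbhs u [set v : cantor_space | v n = u n].
  exact: (@proj_continuous nat (fun=> bool) n u [set b | b = u n]).
move=> /(filterI IH); apply: filterS => v [uv vn] i.
by rewrite ltnS leq_eqVlt => /predU1P[->|/uv].
Qed.

Lemma cyl_base (u : cantor_space) O : nbhs u O -> exists n, cyl u n `<=` O.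
Proof.
pose G := filter_from [set: nat] (cyl u).
have FG : Filter G.
  apply: filter_from_filter; first by exists 0%N.
  move=> n m _ _; exists (maxn n m) => // v uv.
  by split=> i ilt; apply: uv; rewrite leq_max ilt ?orbT.
suff : G --> u by move=> Gu /Gu [n _ nO]; exists n.
apply/(@pointwise_cvgP nat bool G u) => n P /nbhs_singleton /= Pun.
by exists n.+1 => // v uv; rewrite /= uv.
Qed.

Lemma cyl_cvg (u : nat -> cantor_space) v :
  (forall n, exists N, forall m, (N <= m)%N -> cyl v n (u m)) -> u @ \oo --> v.
Proof.
move=> uv O /cyl_base [n nO]; have [N uN] := uv n.
by exists N => // m /uN /nO.
Qed.

Definition flip (u : cantor_space) d : cantor_space :=
  fun i => if i == d then ~~ u i else u i.

Lemma flip_cvg u : flip u @ \oo --> u.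
Proof.
apply: cyl_cvg => n; exists n => m nm i ilt; rewrite /flip.
by case: eqP ilt => // ->; rewrite ltnNge nm.
Qed.

Local Notation omega1 := (order_topology omega_plus_one).

Lemma omega_ltS m n : ((Some m : omega1) < Some n)%O = (m < n)%N.
Proof. by rewrite lt_neqAle ltn_neqAle. Qed.

Lemma omega_tail (O : set omega1) : nbhs (None : omega1) O ->
  exists N, forall n, (N <= n)%N -> O (Some n).
Proof.
rewrite itv_nbhsE => -[i [+ iN] iO].
case: i iN iO => [[[] [m|]|[]] [[] [k|]|[]]] //= iN iO _.
  by exists m.+1 => n mn; apply: iO; rewrite /= in_itv /= andbT omega_ltS.
by exists 0%N => n _; apply: iO; rewrite /= in_itv.
Qed.

Lemma omega_isolated n : nbhs (Some n : omega1) [set Some n : omega1].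
Proof.
have lo : nbhs (Some n : omega1) [set x : omega1 | if x is Some m then (n <= m)%N else True].
  case: n => [|n]; first by apply: filterS filterT => -[].
  apply: (@filterS _ _ _ [set` `]Some n : omega1, +oo[%O]).
    by move=> [m|] //=; rewrite in_itv /= andbT omega_ltS.
  by apply: open_nbhs_nbhs; split; [exact: rray_open|rewrite /= in_itv /= andbT omega_ltS].
have hi : nbhs (Some n : omega1) [set` `]-oo, Some n.+1 : omega1[%O].
  by apply: open_nbhs_nbhs; split; [exact: lray_open|rewrite /= in_itv /= omega_ltS].
apply: filterS (filterI lo hi) => -[m|] [nm]; rewrite /= in_itv //= omega_ltS ltnS => mn.
by congr Some; apply/eqP; rewrite eqn_leq mn.
Qed.

Lemma omega_tail_nbhs N :
  nbhs (None : omega1) [set x : omega1 | if x is Some n then (N <= n)%N else True].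
Proof.
apply: (@filterS _ _ _ [set` `]Some N : omega1, +oo[%O]).
  by move=> [m|] //=; rewrite in_itv /= andbT omega_ltS => /ltnW.
by apply: open_nbhs_nbhs; split; [exact: rray_open|rewrite /= in_itv].
Qed.

Lemma omega_continuous (T : topologicalType) (g : omega1 -> T) :
  (fun n => g (Some n)) @ \oo --> g None -> continuous g.
Proof.
move=> gN [n|] O; first by move=> /nbhs_singleton gO; apply: filterS (omega_isolated n) => _ ->.
move=> gO; have [N _ NO] := gN _ gO; apply: filterS (omega_tail_nbhs N) => -[n /NO //|_].
exact: nbhs_singleton gO.
Qed.

Section Increasing.
Context (d : nat -> nat) (dlt : forall n, (d n < d n.+1)%N).

Lemma incr_lt m n : (m < n)%N -> (d m < d n)%N.
Proof. exact: (@homo_ltn _ d (fun x y => x < y)%N ltn_trans). Qed.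

Lemma incr_inj : injective d.
Proof. by move=> m n; case: (ltngtP m n) => // /incr_lt + dE; rewrite dE ltnn. Qed.

Lemma incr_ltE m n : (d m < d n)%N = (m < n)%N.
Proof.
case: (ltngtP m n) => [/incr_lt //|/incr_lt nm|->]; last by rewrite ltnn.
by apply/negbTE; rewrite -leqNgt ltnW.
Qed.

Lemma incr_ge n : (n <= d n)%N.
Proof. by elim: n => // n IH; exact: leq_ltn_trans IH (dlt n). Qed.

End Increasing.

(** * Points of a tree in one translate *)

Section Trees.
Context (X : topologicalZmodType) (hX : hausdorff_space X) (A : set X).
Hypothesis winA : convexity_game_won A.
Hypothesis locA : forall n (U : set X), nbhs 0 U ->
  nbhs 0 (diff_set (U `&` dyadic_preimage n A)).

(** A tree of height one, rooted at the limit point of [omega + 1]. *)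
Lemma infinite_translate (f : omega1 -> X) : continuous f ->
  exists x, infinite_set (f @^-1` translate A x).
Proof.
move=> cf; pose F (t : omega1) d : omega1 := if t is None then Some d else t.
have cF t : F t @ \oo --> t.
  case: t => [n|]; first exact: cvg_cst.
  by move=> O /omega_tail [N NO]; exists N => // n /NO.
have [d [c [x [dlt c0 cS fI]]]] := game_tree hX winA locA cf cF (j := fun=> 0%N) (fun=> leq0n _) None.
exists x => finA; apply: infinite_nat.
have fd n : (f @^-1` translate A x) (Some (d n)).
  have curE m : cur (pred1 n) m = if (n < m)%N then n.+1 else 0%N.
    elim: m => //= m ->; rewrite ltnS.
    by case: (ltngtP n m) => [nm|nm|->]; rewrite ?eqxx // ?(gtn_eqF nm) ?(ltn_eqF nm).
  apply: (fI (pred1 n)) => [m /eqP ->|]; first by rewrite curE ltnn.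
  apply: (@cvg_near_cst _ _ (f (Some (d n)))).
  by exists n.+1 => // m /= nm; rewrite curE nm cS c0.
have -> : [set: nat] = (fun n => Some (d n) : omega1) @^-1` (f @^-1` translate A x).
  by apply/seteqP; split => // n _; exact: fd.
by apply: finite_preimage => // m n _ _ [] /(incr_inj dlt).
Qed.

(** The [k]-th node of the branch [b] of the binary tree, numbered as in a heap:
    the children of [m] are [2 m + 1] and [2 m + 2], so node [n.+1] is a child of [n./2]. *)
Fixpoint heap (b : nat -> bool) k : nat :=
  if k is l.+1 then ((heap b l).*2 + b l).+1 else 0%N.

Lemma heap_lt b k : (heap b k < heap b k.+1)%N.
Proof. by rewrite /= ltnS -addnn -addnA leq_addr. Qed.

(** The [k]-th level consists of the numbers from [2^k - 1] to [2^(k+1) - 2]. *)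
Lemma heap_level b k : (2 ^ k <= (heap b k).+1 < 2 ^ k.+1)%N.
Proof.
elim: k => [|k /andP[lo hi]] //=; rewrite [(2 ^ k.+2)%N]expnS [(2 ^ k.+1)%N]expnS in hi *.
by case: (b k); rewrite -muln2; lia.
Qed.

Lemma heap_inj b b' k l : heap b k = heap b' l -> k = l.
Proof.
move=> bE; have /andP[lo hi] := heap_level b k; have /andP[lo' hi'] := heap_level b' l.
have := leq_ltn_trans lo; rewrite bE => /(_ _ hi'); have := leq_ltn_trans lo'.
rewrite -bE => /(_ _ hi); rewrite !ltn_exp2l // !ltnS => lk kl.
by apply/eqP; rewrite eqn_leq lk kl.
Qed.

Lemma eq_heap b b' k : (forall i, (i < k)%N -> b i = b' i) ->
  forall l, (l <= k)%N -> heap b l = heap b' l.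
Proof.
move=> bE; elim=> //= l IH lk; rewrite IH ?bE //; exact: ltnW.
Qed.

(** The innings that lead to the nodes of the branch [b]. *)
Definition branch (b : nat -> bool) (n : nat) : bool :=
  `[< exists k, heap b k.+1 = n.+1 >].

Lemma cur_branch b n k : (heap b k <= n < heap b k.+1)%N -> cur (branch b) n = heap b k.
Proof.
have hltE := incr_ltE (heap_lt b).
elim: n k => [|n IH] k /andP[]; first by rewrite leqn0 => /eqP.
rewrite leq_eqVlt => /predU1P[kE _|kn nk] /=.
  case: k kE => // k kE; rewrite ifT //; last by apply/asboolP; exists k.
rewrite ifF; first by apply: IH; rewrite -ltnS kn ltnW.
apply/negbTE/asboolP => -[l lE]; move: kn nk; rewrite -lE !hltE; lia.
Qed.

Section Tree.
Context (f : cantor_space -> X) (cf : continuous f).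

(** Each child is obtained from its parent by flipping one fresh coordinate [d n],
    and the root is the zero sequence, so the end of a branch is the indicator of
    the set of coordinates flipped along it. *)
Lemma cantor_translate : exists (x : X) (e : (nat -> bool) -> cantor_space),
  [/\ injective e,
      forall b, (f @^-1` translate A x) (e b) &
      forall b O, nbhs (e b) O -> exists2 b', b' <> b & O (e b')].
Proof.
have jle n : (n./2 <= n)%N by rewrite leq_half_double -addnn; lia.
have [d [c [x [dlt c0 cS fI]]]] := game_tree hX winA locA cf flip_cvg jle (fun=> false).
pose e b : cantor_space := fun i => `[< exists2 m, branch b m & d m = i >].
have branchP b n : branch b n -> n./2 = cur (branch b) n.
  move=> /asboolP [k kE].
  have nE : n = (b k + (heap b k).*2)%N by rewrite addnC; case: kE.
  rewrite (@cur_branch _ _ k); first by rewrite [in LHS]nE half_bit_double.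
  by rewrite kE ltnSn andbT -ltnS -kE heap_lt.
have branch_heap b k : branch b (heap b k.+1).-1.
  by apply/asboolP; exists k.
have cE b n i :
    c (cur (branch b) n) i = `[< exists2 m, (m < n)%N /\ branch b m & d m = i >].
  elim: n i => [|n IH] i; first by rewrite /= c0; apply/esym/asboolP => -[m []].
  have dropn : ~ (branch b n /\ d n = i) ->
      `[< exists2 m, (m < n.+1)%N /\ branch b m & d m = i >] =
      `[< exists2 m, (m < n)%N /\ branch b m & d m = i >].
    move=> nn; apply: asbool_equiv_eq; split=> -[m [mn bm] dm]; exists m => //.
      split=> //; move: mn; rewrite ltnS leq_eqVlt => /predU1P[mE|//].
      by case: nn; rewrite -mE.
    by split=> //; exact: ltnW.
  rewrite /=; case: ifPn => [bn|nbn]; last by rewrite dropn // => -[bn]; rewrite bn in nbn.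
  rewrite cS (branchP _ _ bn) /flip; case: eqP => [iE|ni]; last first.
    by rewrite dropn // => -[_ /esym].
  rewrite IH iE; transitivity true; last by apply/esym/asboolP; exists n.
  apply/negP => /asboolP [m [mn _] /(incr_inj dlt) mE].
  by rewrite mE ltnn in mn.
exists x, e; split.
- move=> b b' ebb'.
  have hE k : heap b k.+1 = heap b' k.+1.
    have : e b (d (heap b k.+1).-1) by apply/asboolP; exists (heap b k.+1).-1.
    rewrite ebb' => /asboolP [m /asboolP [l lE] /(incr_inj dlt) mE].
    have lk : heap b' l.+1 = heap b k.+1 by rewrite lE mE.
    by rewrite -lk; case: (heap_inj lk) => ->.
  have hE' k : heap b k = heap b' k by case: k.
  apply/funext => k; have := hE k; rewrite /= hE' => -[] /eqP; rewrite eqn_add2l.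
  by case: (b k) (b' k) => -[].
- move=> b; apply: (fI (branch b)); first exact: branchP.
  suff ce : c (cur (branch b) n) @[n --> \oo] --> e b by move=> O /cf /ce.
  apply: cyl_cvg => n; exists n => m nm i ilt; rewrite cE.
  apply: asbool_equiv_eq; split=> [[k [_ bk] dk]|[k bk dk]]; first by exists k.
  by exists k => //; split => //; have := incr_ge dlt k; lia.
- move=> b O /cyl_base [n nO].
  pose b' i := if i == n then ~~ b i else b i.
  have bb' i : (i < n)%N -> b' i = b i by rewrite /b'; case: ltngtP.
  exists b'.
    by move=> /funeqP /(_ n); rewrite /b' eqxx; case: (b n).
  have transfer b1 b2 i : (i < n)%N -> (forall i, (i < n)%N -> b1 i = b2 i) -> e b1 i -> e b2 i.
    move=> ilt b12 /asboolP [m /asboolP [k kE] dm]; apply/asboolP; exists m => //.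
    apply/asboolP; exists k; rewrite -kE; apply/esym/(eq_heap b12).
    have := incr_ge dlt m; have := incr_ge (heap_lt b1) k.+1; lia.
  apply: nO => i ilt; apply/idP/idP; apply: transfer => // k /bb' -> //.
Qed.
End Tree.

(** Cantor's diagonal argument on the branches. *)
Lemma not_haar_countable : ~ haar_countable A.
Proof.
move=> [f cf countf]; have [x [e [einj eA _]]] := cantor_translate cf.
have /countable_injP [h hinj] := countf x.
have hE b b' : h (e b) = h (e b') -> b = b'.
  by move=> hbb; apply: einj; apply: hinj => //; rewrite inE; exact: eA.
pose D n := ~~ `[< exists2 b : nat -> bool, h (e b) = n & b n >].
have [Dn|nDn] := pselect (D (h (e D))).
  by move: (Dn) => /asboolP; apply; exists D.
have : exists2 b : nat -> bool, h (e b) = h (e D) & b (h (e b)).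
  by apply: contrapT => nb; apply: nDn; apply/asboolP => -[b bD bb]; apply: nb; exists b; rewrite // bD.
by move=> [b /hE ->].
Qed.

Lemma not_haar_scattered : ~ haar_scattered A.
Proof.
move=> [f cf scatf]; have [x [e [einj eA eD]]] := cantor_translate cf.
have [||p [/set_mem [b _ <-] [V bV VE]]] := scatf x (range e).
- by move=> _ [b _ <-].
- by exists (e xpred0), xpred0.
have [b' bb' Vb'] := eD b V bV.
have : (V `&` range e) (e b') by split => //; exists b'.
by rewrite VE => /einj.
Qed.

Lemma not_null_finite : ~ null_finite A.
Proof. by move=> [f cf finf]; have [x] := infinite_translate cf; apply. Qed.

End Trees.

(** * The space of maps from the Cantor cube *)

Definition word n (u : cantor_space) : n.-tuple bool := [tuple u i | i < n].

Definition word_point n (w : n.-tuple bool) : cantor_space := nth false w.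

Lemma word_cyl n u : cyl (word_point (word n u)) n u.
Proof. by move=> i ilt; rewrite /word_point /word -[i]/(nat_of_ord (Ordinal ilt)) nth_mktuple. Qed.

Lemma cyl_word n u v : cyl u n v -> word n v = word n u.
Proof. by move=> uv; apply: eq_from_tnth => i; rewrite !tnth_mktuple uv. Qed.

Lemma word_eq n u v : word n u = word n v -> cyl v n u.
Proof.
move=> uv i ilt; have := congr1 (fun w => tnth w (Ordinal ilt)) uv.
by rewrite !tnth_mktuple.
Qed.

Lemma cyl_compact u n : compact (cyl u n).
Proof.
apply: (subclosed_compact _ cantor_space_compact) => // v cv i ilt.
by have [w [uw vw]] := cv _ (cyl_nbhs v n); rewrite -uw // vw.
Qed.

Section FunctionSpace.
Import ArrowAsCompactOpen.
Context (X : topologicalType) (B : nat -> X -> set X) (bB : ball_system B).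
Local Notation C := (continuousType cantor_space X).

Definition sup_ball k (f : C) : set C := [set g | forall u, B k (f u) (g u)].

Lemma sup_oscillation (f : C) k :
  exists N, forall u v, cyl u N v -> B k (f u) (f v).
Proof.
have near_u (u : cantor_space) : [set: cantor_space] u ->
    \forall v \near u & n \near \oo, forall w, cyl v n w -> B k (f v) (f w).
  move=> _; have [n uB] := cyl_base (@cts_fun _ _ f u _ (ball_nbhs bB k.+1 (f u))).
  exists (cyl u n, [set m | (n <= m)%N]) => /=; first by split; [exact: cyl_nbhs|exists n].
  move=> [v m] /= [uv nm] w vw.
  apply: (ball_trans bB (ball_symm bB (uB _ uv))); apply: uB => i ilt.
  by rewrite vw ?uv // (leq_trans ilt).
have /compact_near_coveringP cptC := cantor_space_compact.
have [N _ NP] := cptC nat \oo _ _ near_u.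
by exists N => u v; apply: (NP N) => //=.
Qed.

(** By uniform continuity it suffices to control a map on the finitely many
    cylinders of some length, each by one compact-open condition. *)
Lemma sup_ball_nbhs k f : nbhs f (sup_ball k f).
Proof.
have [N NP] := sup_oscillation f k.+2.
pose P (w : N.-tuple bool) : set (cantor_space -> X) :=
  [set g | g @` cyl (word_point w) N `<=` (B k.+1 (f (word_point w)))°].
have fP w : nbhs f [set g : C | P w (g : cantor_space -> X)].
  have oP : open (P w).
    exact: (compact_open_open (@cyl_compact _ _) (@open_interior _ (B k.+1 (f (word_point w))))).
  have fPw : nbhs (f : cantor_space -> X) (P w).
    apply: open_nbhs_nbhs; split=> // _ [v wv <-].
    by apply: (ball_open_sub bB); exact: NP.
  exact: (@initial_continuous C (cantor_space -> X) id f (P w) fPw).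
have fA : nbhs f [set g : C | forall w, P w (g : cantor_space -> X)]
  by exact: (@nbhs_forall C _ f (fun w => [set g : C | P w (g : cantor_space -> X)]) fP).
apply: filterS fA => g gP u.
have gu : B k.+1 (f (word_point (word N u))) (g u).
  by apply: interior_subset; apply: (gP (word N u)); exists u => //; exact: word_cyl.
apply: (ball_trans bB _ gu); apply: (ball_symm bB).
by apply: (ball_le bB (leqnSn _)); apply: NP; exact: word_cyl.
Qed.

Lemma sup_ball_base f (O : set C) : nbhs f O -> exists k, sup_ball k f `<=` O.
Proof.
move=> [_ [[W oW <-] Wf WO]].
pose S k : set (cantor_space -> X) := [set g | forall u, B k (f u) (g u)].
have FG : Filter (filter_from [set: nat] S).
  apply: filter_from_filter; first by exists 0%N.
  move=> n m _ _; exists (maxn n m) => // g gS.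
  by split=> u; apply: (ball_le bB _ (gS u)); rewrite ?leq_maxl ?leq_maxr.
have Gf : filter_from [set: nat] S --> (f : cantor_space -> X).
  apply/(@compact_open_cvgP cantor_space X) => K O' cptK oO' fKO'.
  move/compact_near_coveringP: cptK => cptK.
  have near_u (u : cantor_space) : K u ->
      \forall v \near u & n \near \oo, B n (f v) `<=` O'.
    move=> Ku; have [n nO'] : exists n, B n (f u) `<=` O'.
      by apply: (ball_base bB); apply: open_nbhs_nbhs; split => //; apply: fKO'; exists u.
    have fB := @cts_fun _ _ f u _ (ball_nbhs bB n.+1 (f u)).
    exists (f @^-1` B n.+1 (f u), [set m | (n < m)%N]) => /=; first by split => //; exists n.+1.
    move=> [v m] /= [uv nm] y vy; apply: nO'; apply: (ball_trans bB uv).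
    exact: (ball_le bB nm).
  have [N _ NP] := cptK nat \oo _ _ near_u.
  by exists N => // g gS _ [u Ku <-]; apply: (NP N _ _ Ku) => //=.
have [k _ kW] : filter_from [set: nat] S W by apply: Gf; exact: open_nbhs_nbhs.
by exists k => g gk; apply: WO; exact: kW.
Qed.

Lemma sup_ball_system : ball_system sup_ball.
Proof.
split.
- exact: sup_ball_nbhs.
- exact: sup_ball_base.
- by move=> k f g fg u; exact: (ball_symm bB (fg u)).
- by move=> k f g h fg gh u; exact: (ball_trans bB (fg u) (gh u)).
Qed.

Lemma continuousType_of (f : cantor_space -> X) : continuous f -> exists g : C, forall u, g u = f u.
Proof. by move=> cf; exists (mkcts cf : C). Qed.

Lemma sup_ball_complete : complete_balls B -> complete_balls sup_ball.
Proof.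
move=> cB u uP.
have /choice [g ug] (t : cantor_space) : exists y : X, u n t @[n --> \oo] --> y.
  by apply: cB => k l kl; exact: uP.
have uB k n t : (k < n)%N -> B k (u n t) (g t).
  move=> kn; apply: (ball_lim bB (ug t)); exists n => // m /= nm.
  by apply: (ball_le bB kn); exact: uP.
have cg : continuous g.
  move=> t O /(ball_base bB) [k kO].
  have fB : nbhs t [set s | B k.+2 (u k.+3 t) (u k.+3 s)].
    exact: (@cts_fun _ _ (u k.+3) t _ (ball_nbhs bB k.+2 (u k.+3 t))).
  apply: filterS fB => s ts; apply: kO.
  apply: (ball_trans bB (ball_symm bB (uB k.+1 k.+3 t _))) => //.
  exact: (ball_trans bB ts (uB _ _ _ _)).
have [h hE] := continuousType_of cg; exists h => O /sup_ball_base [k kO].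
exists k.+2 => // n /= kn; apply: kO => t; rewrite hE.
apply: (ball_trans bB (ball_symm bB (uB k.+1 n t _))) => //.
exact: ball_refl.
Qed.

End FunctionSpace.

(** * Generic maps *)

Section Generic.
Import ArrowAsCompactOpen.
Context (R : realType) (X : topologicalZmodType) (polishX : polish_space R X).
Local Notation C := (continuousType cantor_space X).

Lemma subl_continuous (x : X) : continuous (fun z => x - z).
Proof.
move=> z; apply: (@continuous_comp _ _ _ (fun z : X => (x, z)) (fun p : X * X => p.1 - p.2)).
  by apply: cvg_pair => /=; [exact: cvg_cst|exact: cvg_id].
exact: sub_continuous.
Qed.

(** The points are chosen one at a time, each off finitely many meager sets. *)
Lemma general_position (I : finType) (U : I -> set X) (x0 : I -> X) (F : set X) :
  (forall i, nbhs (x0 i) (U i)) -> meager F ->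
  exists x : I -> X, (forall i, U i (x i)) /\ forall i k, i <> k -> ~ F (x i - x k).
Proof.
move=> nU mF.
suff [x Ux xF] : exists2 x : I -> X, forall i, U i (x i) &
    forall i k, i \in enum I -> k \in enum I -> i <> k -> ~ F (x i - x k).
  by exists x; split=> // i k; apply: xF; rewrite mem_enum.
elim: (enum I) => [|a s [x Ux xF]].
  by exists x0 => // i; exact: nbhs_singleton.
have [y Uy yF] : exists2 y, U a y & forall i, ~ F (y - x i) /\ ~ F (x i - y).
  apply: contrapT => ny; apply: (nonmeager_nbhs polishX (nU a)).
  apply: (@meagerS _ _ (\bigcup_i ([set z | F (z + (- x i))] `|` [set z | F (x i - z)]))).
    move=> z Uz; apply: contrapT => nz; apply: ny; exists z => // i.
    by split=> Fz; apply: nz; exists i => //; [left|right].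
  apply: meager_bigcup => i; apply: meagerU; first exact: meager_shift.
  apply: (@meager_homeo _ _ (fun z => x i - z)) => //; try exact: subl_continuous.
  - by move=> z; rewrite subKr.
  - by move=> z; rewrite subKr.
exists (fun i => if i == a then y else x i).
  by move=> i; case: eqP => [->|].
move=> i k; rewrite !inE.
case: (eqVneq i a) => [->|_]; case: (eqVneq k a) => [->|_] //= is_ ks ik.
- exact: (yF k).1.
- exact: (yF i).2.
- exact: xF.
Qed.

(** A map can be approximated by one that is constant on the cylinders of some length
    [N >= m], with values [x w] in general position.  All differences of values at points of
    distinct cylinders then avoid [F], and, [F] being closed, they still do for
    nearby maps. *)
Lemma coincidence_nowhere_dense (m : nat) (F : set X) : closed F -> nowhere_dense F ->
  nowhere_dense [set h : C | exists u v, [/\ exists2 i, (i < m)%N & u i <> v i & F (h u - h v)]].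
Proof.
move=> cF ndF; have [B bB _] := polish_balls polishX.
have bsup := sup_ball_system bB.
apply/nowhere_denseP => O oO [f Of].
have [k kO] := ball_base bsup (open_nbhs_nbhs (conj oO Of)).
(* Length at least [m], so that points differing before [m] lie in distinct cylinders. *)
have [N0 N0P] := sup_oscillation bB f k.+1.
pose N := maxn N0 m.
have NP u v : cyl u N v -> B k.+1 (f u) (f v).
  by move=> uv; apply: N0P => i ilt; apply: uv; rewrite leq_max ilt.
have [x [xB xF]] := general_position (fun w : N.-tuple bool =>
  ball_nbhs bB k.+1 (f (word_point w))) (nowhere_dense_meager ndF).
have [g gE] : exists g : C, forall u, g u = x (word N u).
  apply: continuousType_of => u; apply: cvg_near_cst.
  by apply: filterS (cyl_nbhs u N) => v uv /=; rewrite (cyl_word uv).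
have Og : O g.
  apply: kO => u; rewrite gE; apply: (ball_trans bB _ (xB _)); apply: (ball_symm bB).
  by apply: NP; exact: word_cyl.
pose G (p : N.-tuple bool * N.-tuple bool) : set C :=
  [set h | forall u v, word N u = p.1 -> word N v = p.2 -> p.1 <> p.2 -> ~ F (h u - h v)].
have nG p : nbhs g (G p).
  have [pE|/eqP pE] := eqVneq p.1 p.2.
    by apply: filterS filterT => h _ u v _ _.
  have nF : nbhs (x p.1, x p.2) [set q : X * X | ~ F (q.1 - q.2)].
    apply: (@sub_continuous X (x p.1, x p.2) (~` F)).
    by apply: open_nbhs_nbhs; split; [exact: closed_openC|exact: xF].
  have [[V W] /= [/(ball_base bB) [l lV] /(ball_base bB) [l' lW]] VWF] := nF.
  apply: filterS (filterI (ball_nbhs bsup l g) (ball_nbhs bsup l' g)) => h [gl gl'] u v uE vE _.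
  apply: (VWF (h u, h v)); split=> /=.
    by apply: lV; rewrite -uE -gE; exact: gl.
  by apply: lW; rewrite -vE -gE; exact: gl'.
pose GA := [set h : C | forall p, G p h].
have nGA : nbhs g GA by exact: (@nbhs_forall C _ g G).
exists (O `&` GA°); split.
- by apply: openI => //; exact: open_interior.
- by exists g.
- exact: subIsetl.
- rewrite -subset0 => h [[_ /interior_subset hG] [u [v [[i im uvi] Fh]]]].
  apply: (hG (word N u, word N v) u v erefl erefl _ Fh) => /= /word_eq uv.
  by apply: uvi; apply: uv; rewrite leq_max im orbT.
Qed.

Lemma meager_generically_haar1 (A : set X) :
  meager (diff_set A) -> generically_haar1 A.
Proof.
move=> [F ndF AF]; rewrite /generically_haar1 /comeager.
apply: (@meagerS _ _ (\bigcup_(p : nat * nat) [set h : C | exists u v,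
    [/\ exists2 i, (i < p.1)%N & u i <> v i & closure (F p.2) (h u - h v)]])).
  move=> h /= /existsNP [x /existsNP [u /existsNP [v]]].
  move=> /not_implyP [[a Aa aE] /not_implyP [[b Ab bE] uv]].
  have [n _ Fn] : (\bigcup_n F n) (h u - h v).
    by apply: AF; exists a => //; exists b => //; rewrite -aE -bE opprD addrACA subrr addr0.
  have [i uvi] : exists i, u i <> v i.
    by apply: contrapT => /forallNP uvE; apply: uv; apply/funext => i; exact: contrapT (uvE i).
  exists (i.+1, n) => //; exists u, v; split; first by exists i.
  exact: subset_closure.
apply: meager_bigcup => -[m n]; apply: nowhere_dense_meager.
by apply: coincidence_nowhere_dense; [exact: closed_closure|exact: nowhere_dense_closure].
Qed.

Lemma generically_haar1_ex (A : set X) : generically_haar1 A ->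
  exists2 f : cantor_space -> X, continuous f & forall x, is_subset1 (f @^-1` translate A x).
Proof.
move=> gA; have [B bB cB] := polish_balls polishX.
have bsup := sup_ball_system bB.
have [f0 _] := continuousType_of (@cst_continuous cantor_space X 0).
apply: contrapT => nf; apply: (baire_balls bsup (sup_ball_complete bB cB) openT).
  by exists f0.
apply: meagerS gA => f _ fA; apply: nf; exists f => //.
exact: cts_fun.
Qed.

End Generic.

(** * Comparison of the smallness conditions *)

Section Final.
Context (R : realType) (X : topologicalZmodType) (polishX : polish_space R X).
Implicit Types (A : set X) (f : cantor_space -> X).

Lemma haar1_thin A f : continuous f ->
  (forall x, is_subset1 (f @^-1` translate A x)) -> haar_thin A.
Proof.
move=> cf fA; exists f => // x n u v /set_mem xu /set_mem xv _.
exact: fA xu xv.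
Qed.

Lemma haar1_scattered A f : continuous f ->
  (forall x, is_subset1 (f @^-1` translate A x)) -> haar_scattered A.
Proof.
move=> cf fA; exists f => // x S SA [s Ss]; exists s; split; first exact/mem_set.
exists setT; first exact: filterT.
apply/seteqP; split=> [t [_ St]|t ->] //.
by apply: fA; [exact: SA St|exact: SA].
Qed.

Lemma haar1_countable A f : continuous f ->
  (forall x, is_subset1 (f @^-1` translate A x)) -> haar_countable A.
Proof.
move=> cf fA; exists f => // x; apply/countable_injP.
by exists (fun=> 0%N) => u v /set_mem xu /set_mem xv _; exact: fA xu xv.
Qed.

Lemma haar1_null_finite A f : continuous f ->
  (forall x, is_subset1 (f @^-1` translate A x)) -> null_finite A.
Proof.
move=> cf fA.
pose g (t : order_topology omega_plus_one) : cantor_space :=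
  if t is Some n then flip (fun=> false) n else fun=> false.
have cg : continuous g by apply: omega_continuous; exact: flip_cvg.
have ginj : injective g.
  have flipE n k : flip (fun=> false) n k = (k == n) by rewrite /flip; case: eqP.
  move=> [m|] [n|] //= mn; last 2 first.
  - by have := congr1 (fun u : cantor_space => u m) mn; rewrite flipE eqxx.
  - by have := congr1 (fun u : cantor_space => u n) mn; rewrite flipE eqxx.
  by have := congr1 (fun u : cantor_space => u m) mn; rewrite !flipE eqxx => /esym/eqP ->.
exists (f \o g); first by move=> t; apply: continuous_comp; [exact: cg|exact: cf].
move=> x; have [->|/set0P [t xt]] := eqVneq ((f \o g) @^-1` translate A x) set0.
  exact: finite_set0.
apply: (@sub_finite_set _ _ [set t]); last exact: finite_set1.
by move=> s xs; apply: ginj; exact: fA xs xt.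
Qed.

(** For large [n], flipping the [n]-th coordinate changes [f] by an element [a - b]
    of [A - A]; then the two points lie in the preimage of one translate of [A]
    although they differ in one coordinate only. *)
Lemma haar_thin_diff_set A : haar_thin A -> ~ nbhs 0 (diff_set A).
Proof.
move=> [f cf fA] nA.
pose u0 : cantor_space := fun=> false.
have [n _ nP] : \forall n \near \oo, diff_set A (f (flip u0 n) - f u0).
  exact: (flip_cvg (cf u0 _ (nbhs_unshift (f u0) nA))).
have [a Aa [b Ab abE]] := nP n (leqnn n).
pose x := f u0 - b.
have xu : (f @^-1` translate A x) u0 by exists b; rewrite // addrC subrK.
have xv : (f @^-1` translate A x) (flip u0 n).
  by exists a => //; rewrite /x addrCA abE addrC subrK.
have := fA x n u0 (flip u0 n) (mem_set xu) (mem_set xv).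
have -> : (fun m : {m : nat | m != n} => u0 (val m)) = (fun m => flip u0 n (val m)).
  by apply/funext => -[m /= /negbTE mn]; rewrite /flip mn.
move=> /(_ erefl) uE; have := congr1 (fun u : cantor_space => u n) uE.
by rewrite /flip eqxx.
Qed.

Lemma translate_translate A a x : translate (translate A a) x = translate A (a + x).
Proof.
apply/seteqP; split => [_ [_ [b Ab <-] <-]|_ [b Ab <-]]; first by exists b; rewrite // addrA.
by exists (b + a); [exists b|rewrite -addrA].
Qed.

Lemma diff_set_translate A a : diff_set (translate A a) = diff_set A.
Proof.
have E (b c : X) : (b + a) - (c + a) = b - c by rewrite opprD addrACA subrr addr0.
apply/seteqP; split=> [_ [_ [b Ab <-] [_ [c Ac <-] <-]]|_ [b Ab [c Ac <-]]].
  by rewrite E; exists b => //; exists c.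
by exists (b + a); [exists b|exists (c + a); [exists c|rewrite E]].
Qed.

Lemma bimid_convex_translate A a : bimid_convex A -> bimid_convex (translate A a).
Proof.
move=> [mA bA]; split.
  move=> _ _ [b Ab <-] [c Ac <-]; have [[h /= hE] _] := mA _ _ Ab Ac; split.
    by exists (h + a); rewrite /half /= addrACA hE addrACA.
  move=> x /= xE; exists (x - a); last by rewrite subrK.
  apply: (mA _ _ Ab Ac).2; rewrite /half /= addrACA xE.
  by rewrite [b + a + _]addrACA -opprD addrK.
move=> _ _ [b Ab <-] [c Ac <-] U UA bU.
have [||x Ux [n n0 xE]] := bA b c Ab Ac [set y | U (y + a)].
- by move=> y /= /UA [z Az /addIr <-].
- have nU : nbhs b [set y | translate A a (y + a) -> U (y + a)] :=
    @addr_shift_continuous X a b _ bU.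
  by rewrite /within /=; apply: filterS nU => y yU Ay; apply: yU; exists y.
exists (x + a) => //; exists n => //.
by rewrite opprD addrACA subrr addr0 xE addrACA subrr addr0.
Qed.

(** Translating [A] so that the winning point becomes zero changes neither [A - A]
    nor the family of translates of [A]. *)
Theorem diff_set_nbhs_not_haar_small A a : bimid_convex A -> sieved A -> A a -> winning_at A a ->
  nbhs 0 (diff_set A) -> [/\ ~ null_finite A, ~ haar_scattered A & ~ haar_countable A].
Proof.
move=> bA sA Aa wA nA; set A' := translate A (- a).
have A'0 : A' 0 by exists a; rewrite ?subrr.
have bA' : bimid_convex A' := bimid_convex_translate (- a) bA.
have sA' : sieved A' by apply: sieved_image sA; exact: addr_shift_continuous.
have nA' : nbhs 0 (diff_set A') by rewrite diff_set_translate.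
have locA' := diff_set_dyadic_local polishX sA' bA' A'0 nA'.
have hX := polish_hausdorff polishX.
have AE x : translate A x = translate A' (x + a).
  by rewrite translate_translate addrC addrK.
split.
- move=> [f cf fA]; apply: (not_null_finite hX wA locA'); exists f => // x.
  by have := fA (x - a); rewrite AE subrK.
- move=> [f cf fA]; apply: (not_haar_scattered hX wA locA'); exists f => // x.
  by have := fA (x - a); rewrite AE subrK.
- move=> [f cf fA]; apply: (not_haar_countable hX wA locA'); exists f => // x.
  by have := fA (x - a); rewrite AE subrK.
Qed.

End Final.

Theorem theorem19p14 (R : realType) (X : topologicalZmodType)
    (polishX : polish_space R X) (A : set X)
    (convA : bimid_convex A) (analyticA : analytic R A)
    (a : X) (Aa : A a) (winA : winning_at A a) :
  [<-> ~ nbhs (0 : X) (diff_set A);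
       meager (diff_set A);
       generically_haar1 A;
       haar_thin A;
       null_finite A;
       haar_scattered A] /\
  (closed (@dyadic_torsion X) ->
   [<-> ~ nbhs (0 : X) (diff_set A);
        meager (diff_set A);
        generically_haar1 A;
        haar_thin A;
        null_finite A;
        haar_scattered A;
        haar_countable A]).
Proof.
have sA : sieved A by apply: analytic_sieved analyticA _; exists a.
have i12 := diff_set_meager polishX sA convA.1.
have i23 := @meager_generically_haar1 _ _ polishX A.
have i3 := @generically_haar1_ex _ _ polishX A.
have i34 : generically_haar1 A -> haar_thin A.
  by move=> /i3 [f cf fA]; exact: haar1_thin cf fA.
have small : nbhs 0 (diff_set A) -> _ := diff_set_nbhs_not_haar_small polishX convA sA Aa winA.
have i41 := @haar_thin_diff_set _ A.
have i51 : null_finite A -> ~ nbhs 0 (diff_set A) by move=> fA /small [].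
have i61 : haar_scattered A -> ~ nbhs 0 (diff_set A) by move=> fA /small [].
have i71 : haar_countable A -> ~ nbhs 0 (diff_set A) by move=> fA /small [].
have i45 : haar_thin A -> null_finite A.
  by move=> /i41/i12/i23/i3 [f cf fA]; exact: haar1_null_finite cf fA.
have i56 : null_finite A -> haar_scattered A.
  by move=> /i51/i12/i23/i3 [f cf fA]; exact: haar1_scattered cf fA.
have i67 : haar_scattered A -> haar_countable A.
  by move=> /i61/i12/i23/i3 [f cf fA]; exact: haar1_countable cf fA.
by split=> [|_]; tfae.
Qed.
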